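(* Almost all cographs have a generalized cospectral mate in the family of cographs. That is, if $c_n$ denotes the number of isomorphism classes of cographs on $n$ vertices and $h_n$ the number of those isomorphism classes of cographs $G$ on $n$ vertices for which there exists a cograph $H$ with $H\not\cong G$, $\mathrm{Spec}(H)=\mathrm{Spec}(G)$ and $\mathrm{Spec}(\overline{H})=\mathrm{Spec}(\overline{G})$, then $h_n/c_n\to 1$ as $n\to\infty$.
   Context: A cograph is a finite simple graph obtained from the single-vertex graph by repeatedly applying disjoint union of two cographs and complementation (equivalently, a graph with no induced path on 4 vertices). $\overline{G}$ denotes the complement of $G$. For a graph $G$ with adjacency matrix $A$, $\mathrm{Spec}(G)$ is the multiset of eigenvalues of $A$. Two graphs are generalized cospectral if they have the same spectrum and their complements have the same spectrum. *)

(* Defs.v *)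
From mathcomp Require Import all_boot all_order all_algebra all_fingroup all_field.
From mathcomp Require Import boolp.
Set Implicit Arguments. Unset Strict Implicit. Unset Printing Implicit Defensive.
Import Order.TTheory GRing.Theory Num.Theory.
Local Open Scope ring_scope.

Definition graph (n : nat) := {set 'I_n * 'I_n}.

Definition adj n (g : graph n) (i j : 'I_n) : bool := (i, j) \in g.

Definition simple_graph n (g : graph n) : bool :=
  [forall i, ~~ adj g i i] && [forall i, forall j, adj g i j == adj g j i].

Definition compl_graph n (g : graph n) : graph n :=
  [set p | (p.1 != p.2) && (p \notin g)].

Definition induced_P4 n (g : graph n) (a b c d : 'I_n) : bool :=
  [&& uniq [:: a; b; c; d], adj g a b, adj g b c, adj g c d,
      ~~ adj g a c, ~~ adj g a d & ~~ adj g b d].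

Definition cograph n (g : graph n) : bool :=
  simple_graph g && [forall a, forall b, forall c, forall d, ~~ induced_P4 g a b c d].

Definition graph_iso n (g h : graph n) : bool :=
  [exists s : 'S_n, forall i, forall j, adj g i j == adj h (s i) (s j)].

Definition adj_mx n (g : graph n) : 'M[algC]_n :=
  \matrix_(i, j) (adj g i j)%:R.

(* Spectrum: the multiset of eigenvalues of the adjacency matrix, given as
   the multiplicity function lambda |-> multiplicity of lambda as a root of
   the characteristic polynomial. *)
Definition Spec n (g : graph n) : algC -> nat :=
  fun x => mup x (char_poly (adj_mx g)).

Definition gen_cospectral n (g h : graph n) : Prop :=
  Spec g = Spec h /\ Spec (compl_graph g) = Spec (compl_graph h).

Definition cographs n : {set graph n} := [set g | cograph g].

Definition cograph_classes n : {set {set graph n}} :=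
  equivalence_partition (@graph_iso n) (cographs n).

Definition c_num n : nat := #|cograph_classes n|.

Definition h_num n : nat :=
  #|[set C in cograph_classes n |
      `[< exists G H : graph n, [/\ G \in C, cograph H, ~~ graph_iso G H
                                   & gen_cospectral G H] >] ]|.

(* Main.v *)
(* A cograph on at least two vertices is determined by its cotree, a rooted tree
   without unary nodes considered up to reordering of children, and by the type
   (union or join) of the root. Replacing inside a cotree a subtree [p] by a
   subtree [q] whose cograph is generalized cospectral to that of [p] yields a
   generalized cospectral cograph, since the determinants of [z - A] and
   [z - A + J] of a union or of a complement only depend on the determinants of
   the parts; and the new cograph is not isomorphic to the old one by uniqueness
   of cotrees. There is such a pair [p], [q] with 15 leaves, so it suffices that
   almost all cotrees contain [p].

   Let [rho] be the radius of convergence of the generating function of cotrees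
   by number of leaves, and [T] its value at [rho], which is finite. A cotree is
   a leaf or a multiset of at least two cotrees, and a cotree avoiding [p] is in
   addition not [p] itself. At [rho] this leaves a slack of [rho ^ 15] in the
   functional inequality for cotrees avoiding [p], so that their generating
   function stays below [T] slightly beyond [rho]. On the other hand the number
   of cotrees is supermultiplicative up to a factor 2, hence grows at least like
   [y ^ -n] for every [y > rho], and cotrees avoiding [p] are exponentially
   rare. *)
Require Import Defs.
From mathcomp Require Import all_boot all_order all_algebra.
From HB Require Import structures.
From mathcomp Require Import all_fingroup all_field.
From mathcomp Require Import boolp.
From mathcomp Require Import ring lra zify.
Set Implicit Arguments. Unset Strict Implicit. Unset Printing Implicit Defensive.
Import Order.TTheory GRing.Theory Num.Theory.

(** * Cotrees *)

(** A leaf is a node without children. Union and join alternate along every branch, so node types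
    are not stored: the type of the root fixes all others. *)
Inductive cotree := Node of seq cotree.

Lemma cotree_ind_foldr (P : cotree -> Prop) :
  (forall s, foldr (fun t Q => P t /\ Q) True s -> P (Node s)) -> forall t, P t.
Proof.
move=> H; fix IH 1; case=> s; apply: H.
by elim: s => [|t s IHs] //=.
Qed.

Fixpoint encode t : GenTree.tree void :=
  let: Node s := t in GenTree.Node 0 (map encode s).

Fixpoint decode (u : GenTree.tree void) : cotree :=
  if u is GenTree.Node _ s then Node (map decode s) else Node [::].

Lemma encodeK : cancel encode decode.
Proof.
elim/cotree_ind_foldr=> s IH /=; congr Node.
by elim: s IH => [|t s IHs] //= [-> /IHs ->].
Qed.

HB.instance Definition _ := Countable.copy cotree (can_type encodeK).

Lemma cotree_ind_mem (P : cotree -> Prop) :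
  (forall s, {in s, forall t, P t} -> P (Node s)) -> forall t, P t.
Proof.
move=> H; elim/cotree_ind_foldr=> s IH; apply: H.
elim: s IH => [|t s IHs] //= [Pt Ps] u; rewrite inE => /orP[/eqP-> //|].
exact: IHs.
Qed.

Definition children t := let: Node s := t in s.

Fixpoint leaves t : nat :=
  let: Node s := t in if s is [::] then 1 else sumn (map leaves s).

Fixpoint wf t : bool := let: Node s := t in (size s != 1) && all wf s.

(** An arbitrary total order, taken from the enumeration of the countable type; it only has to
    single out one ordering of each multiset of children. *)
Definition cotree_le (t u : cotree) := pickle t <= pickle u.

Fixpoint canon t : cotree := let: Node s := t in Node (sort cotree_le (map canon s)).

Lemma cotree_le_total : total cotree_le.
Proof. by move=> t u; exact: leq_total. Qed.

Lemma cotree_le_trans : transitive cotree_le.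
Proof. by move=> t u v; exact: leq_trans. Qed.

Lemma cotree_le_anti : antisymmetric cotree_le.
Proof.
by move=> t u; rewrite /cotree_le -eqn_leq => /eqP/(pcan_inj pickleK).
Qed.

Lemma leaves_gt0 t : 0 < leaves t.
Proof.
elim/cotree_ind_mem: t => -[|t s] IH //=.
by rewrite ltn_addr // IH ?mem_head.
Qed.

Lemma leaves_Node s : s != [::] -> leaves (Node s) = sumn (map leaves s).
Proof. by case: s. Qed.

Lemma leaves_canon t : leaves (canon t) = leaves t.
Proof.
elim/cotree_ind_mem: t => s IH; case: (eqVneq s [::]) => [-> //|sN0].
have sN0' : sort cotree_le (map canon s) != [::].
  by rewrite -size_eq0 size_sort size_map size_eq0.
rewrite [canon _]/= !leaves_Node //.
have -> : sumn (map leaves (sort cotree_le (map canon s)))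
        = sumn (map leaves (map canon s)).
  by apply/perm_sumn/perm_map; rewrite perm_sort.
by congr sumn; rewrite -map_comp; apply/eq_in_map => t /IH.
Qed.

Lemma wf_canon t : wf t -> wf (canon t).
Proof.
elim/cotree_ind_mem: t => s IH /= /andP[s1 /allP ws].
rewrite size_sort size_map s1 /= all_sort all_map.
by apply/allP => t ts /=; exact: IH ts (ws _ ts).
Qed.

Lemma canon_id t : canon (canon t) = canon t.
Proof.
elim/cotree_ind_mem: t => s IH /=; congr Node.
have E : map canon (sort cotree_le (map canon s)) = sort cotree_le (map canon s).
  rewrite -[RHS]map_id; apply/eq_in_map => t.
  by rewrite mem_sort => /mapP[u us ->]; exact: IH.
by rewrite E; apply: sorted_sort; [exact: cotree_le_trans|exact: sort_sorted cotree_le_total _].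
Qed.

(** * Graphs represented by cotrees *)

Section Representation.
Variables (T : finType) (e : rel T).
Implicit Types (A C D : {set T}) (b : bool) (s : seq cotree).

(* [b = false]: no edges between the two sets; [b = true]: all edges. *)
Definition uniform b C D := forall x y, x \in C -> y \in D -> e x y = b.

(** Peels off the vertex sets of the children one at a time, each joined uniformly to all that
    remains. The predicate for the children is a parameter so that [rep] can call itself through
    this loop. *)
Definition reps_of (P : cotree -> {set T} -> Prop) b :=
  fix loop s A : Prop :=
    if s is t :: s' then
      exists C, [/\ C \subset A, P t C, loop s' (A :\: C) & uniform b C (A :\: C)]
    else A = set0.

(* [rep t b A]: the subgraph induced on [A] has cotree [t], the root being a
   union node if [b = false] and a join node if [b = true]. *)
Fixpoint rep t b A : Prop :=
  let: Node s := t in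
  if s is [::] then #|A| = 1 else reps_of (fun u => rep u (~~ b)) b s A.

Definition reps b s A := reps_of (fun u => rep u (~~ b)) b s A.

Lemma rep_Node b s A : s != [::] -> rep (Node s) b A = reps b s A.
Proof. by case: s. Qed.

Lemma reps1 b t A : rep t (~~ b) A -> reps b [:: t] A.
Proof. by exists A; split; rewrite ?setDv // => x y; rewrite inE. Qed.

Lemma rep_card t b A : rep t b A -> #|A| = leaves t.
Proof.
elim/cotree_ind_mem: t b A => s IH b A.
case: (eqVneq s [::]) => [-> //|sN0]; rewrite rep_Node // leaves_Node //.
elim: s A IH {sN0} => [|t s IHs] A IH /=; first by move->; rewrite cards0.
case=> C [CA rC rs _].
rewrite -(IH t _ (~~ b) C) ?mem_head // -(IHs (A :\: C)) //.
  by rewrite -(cardsID C A) (setIidPr CA).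
by move=> u us; apply: IH; rewrite inE us orbT.
Qed.

Lemma rep_neq0 t b A : rep t b A -> A != set0.
Proof. by move/rep_card=> cA; rewrite -card_gt0 cA leaves_gt0. Qed.

Hypothesis e_sym : symmetric e.

Lemma uniform_sym b C D : uniform b C D -> uniform b D C.
Proof. by move=> H x y xD yC; rewrite e_sym; exact: H. Qed.

Lemma uniformS b C D C' D' :
  C' \subset C -> D' \subset D -> uniform b C D -> uniform b C' D'.
Proof.
by move=> /subsetP sC /subsetP sD H x y /sC xC /sD yD; exact: H.
Qed.

(** A disconnected graph has a connected complement, and dually. The first part [C] and the rest
    [A :\: C] are nonempty and completely joined by pairs of type [b], and no such pair can be
    separated by [D]. *)
Lemma rep_connected t b A D : wf t -> rep t b A ->
  D \subset A -> D != set0 -> uniform (~~ b) D (A :\: D) -> D = A.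
Proof.
case: t => -[_ /= A1 DA D0 _|t [|u s]] //.
  by apply/eqP; rewrite eqEcard DA A1 card_gt0.
move=> _ [C [CA rC rs uC]] DA.
have [x xC] := set0Pn _ (rep_neq0 rC).
have [y yAC] : exists y, y \in A :\: C.
  case: rs => C' [C'A /rep_neq0/set0Pn[y yC'] _ _].
  by exists y; exact: (subsetP C'A).
case/set0Pn=> z zD uD; apply/eqP; rewrite eqEsubset DA /=.
have cross v w : v \in C -> w \in A :\: C -> (v \in D) = (w \in D).
  move=> vC wAC; have e1 := uC _ _ vC wAC.
  have vA := subsetP CA _ vC; have wA : w \in A by case/setDP: wAC.
  apply/idP/idP => H; apply/negP => /negP K.
    by have := uD v w H; rewrite inE K wA e1 => /(_ isT); case: (b).
  by have := uD w v H; rewrite inE K vA e_sym e1 => /(_ isT); case: (b).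
apply/subsetP => v vA.
have E w : w \in A -> (w \in D) = (x \in D).
  move=> wA; case wC : (w \in C); last by apply/esym/cross; rewrite // inE wC.
  by rewrite (cross w y) // (cross x y).
by rewrite (E v) // -(E z) // (subsetP DA).
Qed.

Lemma uniformDl b C D E : uniform b C E -> uniform b D E -> uniform b (C :|: D) E.
Proof. by move=> uC uD x y /setUP[/uC|/uD]; apply. Qed.

Lemma reps_cons b t s A C : C \subset A -> rep t (~~ b) C ->
  reps b s (A :\: C) -> uniform b C (A :\: C) -> reps b (t :: s) A.
Proof. by exists C; split. Qed.

(** The head part [C'] either misses [C], and the search continues, or meets it; then [C :&: C'] is
    cut off from the rest of either set by pairs of type [b], and connectivity of both sets forces
    [C = C']. *)
Lemma reps_remove b s A C : reps b s A -> all wf s ->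
  C \subset A -> C != set0 -> uniform b C (A :\: C) ->
  (forall D, D \subset C -> D != set0 -> uniform b D (C :\: D) -> D = C) ->
  exists s1 t s2, [/\ s = s1 ++ t :: s2, rep t (~~ b) C
                    & reps b (s1 ++ s2) (A :\: C)].
Proof.
move=> rs ws CA C0 uC connC; elim: s A rs ws CA uC => [|t s IH] A /=.
  by move=> -> _; rewrite subset0 (negbTE C0).
case=> C' [C'A rC' rs uC'] /andP[wt ws] CA uC.
have [C'C0|meet] := eqVneq (C :&: C') set0.
  have CAC' : C \subset A :\: C'.
    by rewrite subsetD CA -setI_eq0 C'C0 eqxx.
  have C'AC : C' \subset A :\: C.
    by rewrite subsetD C'A -setI_eq0 setIC C'C0 eqxx.
  have [|s1 [u [s2 [-> ru rsu]]]] := IH _ rs ws CAC'.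
    by apply: uniformS uC => //; rewrite setSD // subsetDl.
  exists (t :: s1), u, s2; split=> //=; apply: (reps_cons (C := C')) => //.
    by rewrite setDDl setUC -setDDl.
  by apply: uniformS uC' => //; rewrite setSD ?subsetDl.
have CC' : C :&: C' = C.
  apply: connC => //; first exact: subsetIl.
  apply: uniformS uC'; first exact: subsetIr.
  by rewrite setDIr setDv set0U setSD.
have C'C : C :&: C' = C'.
  apply: rep_connected rC' _ meet _ => //; first exact: subsetIr.
  rewrite negbK; apply: uniformS uC; first exact: subsetIl.
  by rewrite setDIr setDv setU0 setSD.
have E : C' = C by rewrite -C'C CC'.
by exists [::], t, s; rewrite -E; split.
Qed.

Lemma reps_extract b s1 t s2 A : reps b (s1 ++ t :: s2) A ->
  exists C, [/\ C \subset A, rep t (~~ b) C, reps b (s1 ++ s2) (A :\: C)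
              & uniform b C (A :\: C)].
Proof.
elim: s1 A => [|u s1 IH] A //= [C [CA rC /IH[D [DA rD rs uD]] uC]].
have DC : [disjoint D & C] by move: DA; rewrite subsetD => /andP[].
have CD : C \subset A :\: D by rewrite subsetD CA disjoint_sym.
exists D; split=> //.
- exact: subset_trans DA (subsetDl _ _).
- apply: (reps_cons CD) => //; first by rewrite setDDl setUC -setDDl.
  by apply: uniformS uC; rewrite // setSD // subsetDl.
have -> : A :\: D = (A :\: C) :\: D :|: C.
  apply/setP => x; rewrite !inE; case xC: (x \in C) => /=; last by rewrite orbF.
  by rewrite orbT (subsetP CA) // (disjointFl DC).
apply: uniform_sym; apply: uniformDl; first exact: uniform_sym.
exact: uniformS uC.
Qed.

Lemma reps_perm b s s' A : perm_eq s s' -> reps b s A -> reps b s' A.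
Proof.
elim: s' s A => [|t s' IH] s A ps rs; first by move: rs; rewrite (perm_nilP ps).
have ts : t \in s by rewrite (perm_mem ps) mem_head.
case/path.splitPr: s / ts ps rs => s1 s2 ps /reps_extract[C [CA rC rs uC]].
apply: (reps_cons CA) => //; apply: IH rs.
by move: ps; rewrite perm_catC /= perm_cons perm_catC.
Qed.

Lemma rep_canon t b A : rep t b A -> rep (canon t) b A.
Proof.
elim/cotree_ind_mem: t b A => s IH b A; case: (eqVneq s [::]) => [-> //|sN0].
rewrite rep_Node // [canon _]/= rep_Node; last first.
  by rewrite -size_eq0 size_sort size_map size_eq0.
move=> rs; apply: (@reps_perm _ (map canon s)); first by rewrite perm_sym perm_sort.
elim: s A IH rs {sN0} => [|t s IHs] A IH //= [C [CA rC rs uC]].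
apply: (reps_cons CA) => //; first by apply: IH; rewrite ?mem_head.
by apply: IHs => // u us; apply: IH; rewrite inE us orbT.
Qed.

(** The parts at the root are the components of the graph or of its complement, hence determined by
    [A]. Each part of the first cotree is found among those of the second, has the same canonical
    form by induction, and is removed from both. *)
Lemma rep_uniq t u b A : wf t -> wf u -> rep t b A -> rep u b A -> canon t = canon u.
Proof.
elim/cotree_ind_mem: t u b A => s IH [s'] b A wt wu rt ru.
have : leaves (Node s) = leaves (Node s') by rewrite -(rep_card rt) (rep_card ru).
have big r : wf (Node r) -> r != [::] -> 1 < leaves (Node r).
  case: r => [|t [|u r]] //= _ _.
  by rewrite addnA ltn_addr // -addn1 leq_add ?leaves_gt0.
have [sE|sN0] := eqVneq s [::].
  have [-> //|/big - /(_ wu) K] := eqVneq s' [::]; first by rewrite sE.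
  by rewrite sE => E; rewrite -E in K.
have [sE|sN0'] := eqVneq s' [::].
  by move/big: sN0 => /(_ wt) + E; rewrite E sE.
move=> _ /=; congr Node; apply/perm_sortP.
- exact: cotree_le_total.
- exact: cotree_le_trans.
- exact: cotree_le_anti.
move: wt wu rt ru; rewrite !rep_Node // => /= /andP[_ ws] /andP[_ ws'].
elim: s s' A IH ws ws' {sN0 sN0' big} => [|t s IHs] s' A IH /=.
  move=> _ _ A0; case: s' => [|u s'] //= [C [CA /rep_neq0 C0 _ _]].
  by move: CA; rewrite A0 subset0 (negbTE C0).
case/andP=> wt ws ws' [C [CA rC rs uC]] rs'.
have [|s1 [u [s2 [E ru rs12]]]] := reps_remove rs' ws' CA (rep_neq0 rC) uC.
  by move=> D DC D0 uD; apply: rep_connected rC DC D0 _ => //; rewrite negbK.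
move: ws'; rewrite E all_cat /= => /and3P[w1 wu w2].
have -> : canon t = canon u by apply: IH rC ru; rewrite ?mem_head.
rewrite map_cat /= perm_sym perm_catC /= perm_cons perm_catC -map_cat perm_sym.
apply: (IHs _ (A :\: C)) => //; last by rewrite all_cat w1.
by move=> v vs; apply: IH; rewrite inE vs orbT.
Qed.
End Representation.

(** With [d = true] the map complements all pairs, which turns a union root into a join root; with
    [d = false] it embeds an induced subgraph. *)
Lemma rep_imset (T T' : finType) (e : rel T) (e' : rel T') (f : T -> T') d :
  injective f -> (forall x y, x != y -> e' (f x) (f y) = e x y (+) d) ->
  forall t b A, rep e t b A -> rep e' t (b (+) d) (f @: A).
Proof.
move=> fI fe t; elim/cotree_ind_mem: t => s IH b A.
have [->|sN0] := eqVneq s [::]; first by rewrite /= card_imset.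
rewrite !rep_Node //.
elim: s A IH {sN0} => [|t s IHs] A IH /=; first by move->; rewrite imset0.
case=> C [CA rC rs uC].
have fD : (f @: A) :\: (f @: C) = f @: (A :\: C).
  apply/setP => y; apply/idP/idP => [/setDP[/imsetP[x xA ->] xC]|/imsetP[x /setDP[xA xC] ->]].
    rewrite mem_imset // inE xA andbT; apply: contra xC; exact: imset_f.
  by rewrite inE !mem_imset // xC.
exists (f @: C); split; first exact: imsetS.
- by rewrite -addNb; apply: IH; rewrite ?mem_head.
- by rewrite fD; apply: IHs => // u us; apply: IH; rewrite inE us orbT.
rewrite fD => _ _ /imsetP[x xC ->] /imsetP[y yC ->].
rewrite fe ?uC //; apply: contraL yC => /eqP <-.
by rewrite inE xC.
Qed.

(** * Seinsche's theorem and the existence of cotrees *)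

Section Seinsche.
Variables (T : finType) (e : rel T).
Hypothesis e_sym : symmetric e.

(* An induced path [x - y - z - w] of the graph if [b = false], and of its
   complement if [b = true]. *)
Definition P4 b x y z w :=
  uniq [:: x; y; z; w] /\
  [/\ e x y = ~~ b, e y z = ~~ b & e z w = ~~ b] /\
  [/\ e x z = b, e x w = b & e y w = b].

(** A path on four vertices is self-complementary, with the vertices taken in another order. *)
Lemma P4_compl b x y z w : P4 b x y z w -> P4 (~~ b) y w x z.
Proof.
case=> U [[xy yz zw] [xz xw yw]]; split; last by split; split; rewrite ?negbK // e_sym.
rewrite -(perm_uniq (s1 := [:: x; y; z; w])) //; apply/seq.permP => p /=.
by case: (p x) (p y) (p z) (p w) => [] [] [] [].
Qed.

Definition P4_free (A : {set T}) b :=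
  forall x y z w, x \in A -> y \in A -> z \in A -> w \in A -> ~ P4 b x y z w.

Lemma P4_freeN A b : P4_free A b -> P4_free A (~~ b).
Proof. by move=> F x y z w xA yA zA wA /P4_compl; rewrite negbK; apply: F. Qed.

Lemma P4_freeS (A B : {set T}) b : B \subset A -> P4_free A b -> P4_free B b.
Proof.
by move=> /subsetP BA F x y z w /BA xA /BA yA /BA zA /BA wA; exact: F.
Qed.

(** Consecutive vertices of the path form pairs of type [~~ b], whereas a part and the remainder are
    joined by type [b]; so the path lies inside one part or inside the remainder. *)
Lemma rep_P4_free t b A : rep e t b A -> P4_free A b.
Proof.
elim/cotree_ind_mem: t b A => s IH b A.
have [->|sN0] := eqVneq s [::].
  move=> /eqP/cards1P[a ->] x y z w; rewrite !inE => /eqP-> /eqP-> _ _ [] /=.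
  by rewrite inE eqxx.
rewrite rep_Node //.
elim: s A IH {sN0} => [|t s IHs] A IH /=; first by move=> -> x; rewrite inE.
case=> C [CA rC rs uC] x y z w xA yA zA wA P.
have side u v : u \in A -> v \in A -> e u v = ~~ b -> (u \in C) = (v \in C).
  move=> uA vA uv; apply/idP/idP => H; apply/negP => /negP K.
    by have := uC u v H; rewrite inE K vA uv => /(_ isT); case: (b).
  by have := uC v u H; rewrite inE K uA e_sym uv => /(_ isT); case: (b).
have [_ [[xy yz zw] _]] := P.
have Exy := side _ _ xA yA xy; have Eyz := side _ _ yA zA yz.
have Ezw := side _ _ zA wA zw.
have [xC|xC] := boolP (x \in C).
  have := P4_freeN (IH t (mem_head _ _) _ _ rC); rewrite negbK => F.
  by apply: (F x y z w) P => //; rewrite -?Ezw -?Eyz -?Exy.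
have F : P4_free (A :\: C) b.
  by apply: IHs rs => u us; apply: IH; rewrite inE us orbT.
by apply: (F x y z w) P => //; rewrite inE -?Ezw -?Eyz -?Exy xC.
Qed.

(** The graph on [A], or its complement if [b] holds, is disconnected, and [C] is a union of
    components. *)
Definition splits b (A C : {set T}) :=
  [/\ C \proper A, C != set0 & uniform e b C (A :\: C)].

(** Inductive step of Seinsche's theorem. If all pairs of [v] have type [~~ b], then [v] splits off
    alone. Otherwise some pair from [v] to, say, [C] has type [b]; then [A :\: C] or [Y] splits off,
    unless there are [w], [x] and [y] that form an induced path with [v]. *)
Lemma splits_add b v (A C : {set T}) : v \notin A -> (forall b, P4_free (v |: A) b) ->
  splits b A C -> exists b' C', splits b' (v |: A) C'.
Proof.
move=> vA F [/properP[CA [d dA dC]] C0 uC].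
have uD := uniform_sym e_sym uC.
have vx x : x \in A -> v != x by move=> xA; apply: contraNneq vA => ->.
have [/forallP all1|] := boolP [forall x, (x \in A) ==> (e v x == ~~ b)].
  exists (~~ b), [set v]; split.
  - apply/properP; split; first by rewrite sub1set setU11.
    by exists d; rewrite ?inE ?dA ?orbT // eq_sym vx.
  - by apply/set0Pn; exists v; rewrite inE.
  - move=> x y; rewrite !inE => /eqP-> /andP[yv]; rewrite (negbTE yv) /=.
    by move=> yA; have /implyP/(_ yA)/eqP := all1 y.
rewrite negb_forall => /existsP[y0]; rewrite negb_imply => /andP[y0A vy0].
wlog y0C : C CA d dA dC C0 uC uD / y0 \in C.
  move=> H; have [y0C|y0C] := boolP (y0 \in C).
    exact: (H C CA d dA dC).
  have [c cC] := set0Pn _ C0.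
  have DK : A :\: (A :\: C) = C by rewrite setDDr setDv set0U; apply/setIidPr.
  apply: (H (A :\: C) _ c); rewrite ?DK ?inE ?cC ?y0C ?subsetDl //.
  - exact: (subsetP CA).
  - by apply/set0Pn; exists d; rewrite inE dC.
pose Y := [set y in C | e v y == b].
pose X := [set x in C | e v x == ~~ b].
have y0Y : y0 \in Y by rewrite inE y0C; move: vy0; case: (e v y0) (b) => [] [].
have vD : v \notin C by apply: contra vA; exact: (subsetP CA).
have [D1|] := boolP [forall w, (w \in A :\: C) ==> (e v w == b)].
  exists b, (A :\: C); split.
  - apply/properP; split; last by exists v; rewrite ?setU11 // inE (negbTE vA) andbF.
    by apply: subset_trans (subsetUr _ _); exact: subsetDl.
  - by apply/set0Pn; exists d; rewrite inE dC.
  - move=> x y xD /setDP[/setU1P[-> _|yA yD]].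
      by rewrite e_sym; have /forallP/(_ x)/implyP/(_ xD)/eqP := D1.
    apply: uD => //; move: yD; rewrite inE yA andbT negbK //.
rewrite negb_forall => /existsP[w]; rewrite negb_imply inE => /andP[/andP[wC wA] vw].
have vw' : e v w = ~~ b by move: vw; case: (e v w) (b) => [] [].
have [YX|] := boolP [forall y, forall x, (y \in Y) ==> (x \in X) ==> (e y x == b)].
  exists b, Y; split.
  - apply/properP; split.
      by apply/subsetP => y; rewrite !inE => /andP[/(subsetP CA) -> _]; rewrite orbT.
    by exists v; rewrite ?setU11 // inE (negbTE vD).
  - by apply/set0Pn; exists y0.
  - move=> y x yY /setDP[/setU1P[-> _|xA xY]].
      by move: yY; rewrite inE e_sym => /andP[_ /eqP].
    have [xC|xC] := boolP (x \in C).
      have xX : x \in X.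
        by move: xY; rewrite !inE xC /=; case: (e v x) (b) => [] [].
      by have /forallP/(_ y)/forallP/(_ x) := YX; rewrite yY xX => /eqP.
    by apply: uC; rewrite ?inE ?xC //; move: yY; rewrite inE => /andP[].
rewrite negb_forall => /existsP[y]; rewrite negb_forall => /existsP[x].
rewrite !negb_imply !inE => /and3P[/andP[yC /eqP vy] /andP[xC /eqP vx'] yx].
have yx' : e x y = ~~ b by rewrite e_sym; move: yx; case: (e y x) (b) => [] [].
have xA := subsetP CA _ xC; have yA := subsetP CA _ yC.
(* The path is [w - v - x - y], where [w] lies on the other side of the old split than [x] and
   [y]. *)
exfalso; apply: (F b w v x y); rewrite ?inE ?wA ?xA ?yA ?eqxx ?orbT //.
have wx := uD w x; have wy := uD w y.
split; last first.
  by split; split; rewrite // ?wx ?wy ?inE ?wC // e_sym.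
have NC u : u \in C -> w != u by move=> uC'; apply: contraNneq wC => ->.
have xy : x != y by apply/eqP => E; move: vy; rewrite -E vx'; case: (b).
by rewrite /= !inE !negb_or (eq_sym w v) !vx // !NC // xy.
Qed.

(** Seinsche's theorem, by deleting a vertex and extending the split of the rest; two vertices split
    by themselves. *)
Lemma splits_exists (A : {set T}) : 1 < #|A| -> (forall b, P4_free A b) ->
  exists b C, splits b A C.
Proof.
move: {2}#|A| (erefl #|A|) => n; elim: n A => [|n IH] A cA; first by rewrite cA.
move=> A1 F; have /card_gt0P[v vA] : 0 < #|A| by rewrite cA.
have cA' : #|A :\ v| = n by move: cA; rewrite (cardsD1 v) vA => -[].
have AE : v |: (A :\ v) = A by rewrite setD1K.
have [n1|n1] := leqP #|A :\ v| 1; last first.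
  have F' b : P4_free (A :\ v) b by apply: P4_freeS (F b); exact: subsetDl.
  have [b [C sC]] := IH _ cA' n1 F'.
  have vA' : v \notin A :\ v by rewrite !inE eqxx.
  by rewrite -AE; apply: (splits_add vA' _ sC); rewrite AE.
have /cards1P[u uE] : #|A :\ v| == 1.
  by rewrite eqn_leq n1; move: A1; rewrite (cardsD1 v) vA.
have uv : u != v by have := set11 u; rewrite -uE !inE => /andP[].
exists (e v u), [set v]; split.
- apply/properP; split; first by rewrite sub1set.
  by exists u; [rewrite -AE uE !inE eqxx orbT | rewrite inE].
- by apply/set0Pn; exists v; rewrite inE.
- by move=> x y; rewrite uE => /set1P-> /set1P->.
Qed.

Lemma reps_cat b s1 s2 (A C : {set T}) : C \subset A -> reps e b s1 C -> reps e b s2 (A :\: C) ->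
  uniform e b C (A :\: C) -> reps e b (s1 ++ s2) A.
Proof.
elim: s1 A C => [|t s1 IH] A C CA /=; first by move=> ->; rewrite setD0.
case=> D [DC rD rs uD] rs2 uC; have DA := subset_trans DC CA.
have DE : (A :\: D) :\: (C :\: D) = A :\: C.
  apply/setP => x; rewrite !inE; case xD: (x \in D) => //=.
  by rewrite (subsetP DC).
apply: (reps_cons DA) => //.
  apply: (IH _ (C :\: D)) => //; rewrite ?DE ?setSD //.
  by apply: (uniformS _ _ uC); rewrite // subsetDl.
have -> : A :\: D = (C :\: D) :|: (A :\: C).
  rewrite -DE -{1}(setID (A :\: D) (C :\: D)); congr (_ :|: _).
  by apply/setIidPr; rewrite setSD.
apply: uniform_sym => //; apply: uniformDl; first exact: uniform_sym.
apply: uniform_sym => //; exact: uniformS uC.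
Qed.

Lemma rep_exists (A : {set T}) : A != set0 -> (forall b, P4_free A b) ->
  exists t b, wf t /\ rep e t b A.
Proof.
move: {2}#|A| (leqnn #|A|) => n; elim: n A => [|n IH] A.
  by rewrite leqn0 cards_eq0 => ->.
move=> cA A0 F; have [A1|A1] := leqP #|A| 1.
  exists (Node [::]), false; split=> //=.
  by apply/eqP; rewrite eqn_leq A1 card_gt0.
have [b [C [CA C0 uC]]] := splits_exists A1 F.
(* Each side yields a list of children for a root of type [b]: the children of its cotree if that
   has root type [b], and otherwise the cotree itself as a single child. A single vertex is a child
   under either type. *)
have step (D : {set T}) : D \proper A -> D != set0 ->
    exists s, [/\ s != [::], all wf s & reps e b s D].
  move=> DA D0.
  have F' b' : P4_free D b' by apply: P4_freeS (F b'); exact: proper_sub.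
  have [|[s] [b' [ws rs]]] := IH _ _ D0 F'.
    by rewrite -ltnS; apply: leq_trans (proper_card DA) cA.
  have [E|NE] := eqVneq b' (~~ b).
    exists [:: Node s]; split=> //; first by rewrite all_seq1.
    by apply: reps1; rewrite -E.
  have {NE} E : b' = b by move: NE; case: (b') (b) => [] [].
  have [sE|sN0] := eqVneq s [::].
    exists [:: Node s]; split=> //; first by rewrite all_seq1.
    by apply: reps1; rewrite sE in rs *.
  exists s; split=> //; first by case/andP: ws.
  by move: rs; rewrite rep_Node // E.
have DA : A :\: C \proper A.
  have [c cC] := set0Pn _ C0.
  apply/properP; split; [exact: subsetDl | exists c; last by rewrite inE cC].
  by rewrite (subsetP (proper_sub CA)).
have D0 : A :\: C != set0.
  by apply/set0Pn; case/properP: CA => _ [d dA dC]; exists d; rewrite inE dC.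
have [s1 [s1N w1 r1]] := step _ CA C0; have [s2 [s2N w2 r2]] := step _ DA D0.
exists (Node (s1 ++ s2)), b; split.
  rewrite /= size_cat all_cat w1 w2 andbT.
  by case: (s1) (s2) s1N s2N => [|? ?] [|? ?] //= _ _; rewrite addnS.
rewrite rep_Node; last by case: (s1) s1N.
exact: reps_cat (proper_sub CA) r1 r2 uC.
Qed.
End Seinsche.

(** * Realization and determinants *)

Record pgraph := PGraph { order : nat; edge : rel 'I_order }.

Definition pempty := @PGraph 0 (fun _ _ => false).
Definition psingle := @PGraph 1 (fun _ _ => false).
Definition pcompl G := @PGraph (order G) (fun i j => (i != j) && ~~ edge i j).
Definition punion G H :=
  @PGraph (order G + order H) (fun i j => match split i, split j with
    | inl a, inl b => edge a b
    | inr a, inr b => edge a b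
    | _, _ => false
    end).

(** The children of a union root have join roots, hence the complement. *)
Definition realize_seq (r : cotree -> pgraph) (s : seq cotree) :=
  foldr (fun t => punion (pcompl (r t))) pempty s.

(* The graph with cotree [t] whose root is a union node. *)
Fixpoint realize t : pgraph :=
  let: Node s := t in if s is [::] then psingle else realize_seq realize s.

Lemma realize_Node s : s != [::] -> realize (Node s) = realize_seq realize s.
Proof. by case: s. Qed.

Lemma edge_realize_sym t : symmetric (edge (p := realize t)).
Proof.
elim/cotree_ind_mem: t => s IH; have [->//|sN0] := eqVneq s [::].
rewrite realize_Node //; elim: s IH {sN0} => [|t s IHs] IH //= i j.
case: (split i) (split j) => [a|a] [c|c] //=.
  by rewrite eq_sym IH ?mem_head.
by apply: IHs => u us; apply: IH; rewrite inE us orbT.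
Qed.

Lemma edge_realize_irr t : irreflexive (edge (p := realize t)).
Proof.
elim/cotree_ind_mem: t => s IH; have [->//|sN0] := eqVneq s [::].
rewrite realize_Node //; elim: s IH {sN0} => [|t s IHs] IH //= i.
case: (split i) => a; first by rewrite eqxx.
by apply: IHs => u us; apply: IH; rewrite inE us orbT.
Qed.

Lemma reps_imset (T T' : finType) (e : rel T) (e' : rel T') (f : T -> T') :
  injective f -> (forall x y, x != y -> e' (f x) (f y) = e x y) ->
  forall s b A, reps e b s A -> reps e' b s (f @: A).
Proof.
move=> fI fe [|t s] b A; first by move=> /= ->; rewrite imset0.
rewrite -!rep_Node // => /(rep_imset (e' := e') (d := false) fI); rewrite addbF.
by apply=> x y /fe ->; rewrite addbF.
Qed.

Lemma split_lshift m n (i : 'I_m) : split (lshift n i) = inl i.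
Proof. exact: (unsplitK (inl i)). Qed.

Lemma split_rshift m n (i : 'I_n) : split (rshift m i) = inr i.
Proof. exact: (unsplitK (inr i)). Qed.

Lemma setTD_lshift m n : [set: 'I_(m + n)] :\: (@lshift m n @: setT) = @rshift m n @: setT.
Proof.
apply/setP => i; rewrite !inE andbT; case: (split_ordP i) => j ->.
  rewrite imset_f ?inE //=; apply/esym/negbTE/imsetP => -[k _ /eqP].
  by rewrite eq_lrshift.
rewrite [RHS]imset_f ?inE //; apply/imsetP => -[k _ /eqP].
by rewrite eq_rlshift.
Qed.

Lemma rep_realize t : rep (edge (p := realize t)) t false setT.
Proof.
elim/cotree_ind_mem: t => s IH; have [->|sN0] := eqVneq s [::].
  by rewrite /= cardsT card_ord.
rewrite realize_Node // rep_Node //.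
elim: s IH {sN0} => [|t s IHs] IH; first by apply/setP => -[].
pose L := @lshift (order (realize t)) (order (realize_seq realize s)).
pose R := @rshift (order (realize t)) (order (realize_seq realize s)).
have st : [set: 'I_(order (realize_seq realize (t :: s)))] :\:
    (L @: [set: 'I_(order (realize t))]) = R @: setT.
  exact: setTD_lshift.
exists (L @: [set: 'I_(order (realize t))]); split.
- exact: subsetT.
- apply: (rep_imset (d := true) _ _ (IH t (mem_head _ _))); first exact: lshift_inj.
  by move=> x y xy /=; rewrite !split_lshift xy addbT.
- rewrite st; apply: (@reps_imset _ _ (edge (p := realize_seq realize s))).
  + exact: rshift_inj.
  + by move=> x y xy /=; rewrite !split_rshift.
  + by apply: IHs => u us; apply: IH; rewrite inE us orbT.
rewrite st => _ _ /imsetP[x _ ->] /imsetP[y _ ->] /=.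
by rewrite split_lshift split_rshift.
Qed.

Lemma order_realize t : order (realize t) = leaves t.
Proof. by rewrite -(rep_card (rep_realize t)) cardsT card_ord. Qed.

(** The embeddings of the parts are glued along the disjoint sum; the complement inside
    [realize_seq] matches the flipped root type of the children. *)
Lemma rep_embed (T : finType) (e : rel T) t b A : symmetric e -> rep e t b A ->
  exists f : 'I_(order (realize t)) -> T,
    [/\ injective f, f @: setT = A
      & forall x y, x != y -> e (f x) (f y) = edge x y (+) b].
Proof.
move=> e_sym; elim/cotree_ind_mem: t b A => s IH b A.
have [->|sN0] := eqVneq s [::].
  move=> /eqP/cards1P[a ->] /=; exists (fun=> a); split.
  - by move=> i j _; rewrite !ord1.
  - apply/setP => x; apply/imsetP/set1P => [[] //|->]; by exists ord0.
  - by move=> i j; rewrite !ord1.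
rewrite rep_Node // realize_Node //.
elim: s A IH {sN0} => [|t s IHs] A IH.
  move=> /= ->; exists (fun i : 'I_0 => match i with Ordinal _ H => match notF H with end end).
  by split; try case=> //; apply/setP => x; rewrite inE; apply/imsetP => -[[]].
case=> C [CA rC rs uC].
have [f1 [f1I f1C f1e]] := IH _ (mem_head _ _) _ _ rC.
have [|f2 [f2I f2C f2e]] := IHs _ _ rs.
  by move=> u us; apply: IH; rewrite inE us orbT.
have in1 x : f1 x \in C by rewrite -f1C imset_f.
have in2 x : f2 x \in A :\: C by rewrite -f2C imset_f.
have in2' x : f2 x \notin C by case/setDP: (in2 x).
exists (fun i => match split i with inl a => f1 a | inr a => f2 a end); split.
- move=> i j; case: (split_ordP i) (split_ordP j) => a -> [] c -> /=;
    rewrite ?split_lshift ?split_rshift.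
  + by move/f1I->.
  + by move=> E; have := in2' c; rewrite -E in1.
  + by move=> E; have := in2' a; rewrite E in1.
  + by move/f2I->.
- apply/setP => x; apply/imsetP/idP => [[i _ ->]|xA].
    case: (split i) => a; first exact: (subsetP CA).
    by case/setDP: (in2 a).
  have [|xC] := boolP (x \in C).
    rewrite -f1C => /imsetP[a _ ->]; exists (lshift _ a) => //.
    by rewrite split_lshift.
  have : x \in A :\: C by rewrite inE xC.
  rewrite -f2C => /imsetP[a _ ->]; exists (rshift _ a) => //.
  by rewrite split_rshift.
move=> i j /=; case: (split_ordP i) (split_ordP j) => a -> [] c ->;
  rewrite ?split_lshift ?split_rshift ?eq_shift => ac.
- by rewrite f1e // ac; case: edge (b) => [] [].
- by rewrite uC.
- by rewrite e_sym uC.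
- exact: f2e.
Qed.

(** * Determinants of complements and disjoint unions *)

Section Determinants.
Variable K : comNzRingType.
Implicit Type z : K.
Local Open Scope ring_scope.

Definition pmx G : 'M[K]_(order G) := \matrix_(i, j) (edge i j)%:R.
Definition pdet G z := \det (z%:M - pmx G).
Definition qdet G z := \det (z%:M - pmx G + const_mx 1).

(** The complement has adjacency matrix [J - 1 - A], and [z - (J - 1 - A) = - ((- 1 - z) - A + J)].
    So complementation exchanges the two determinants up to sign. *)
Lemma pdet_compl G z : irreflexive (edge (p := G)) ->
  pdet (pcompl G) z = (-1) ^+ order G * qdet G (- 1 - z).
Proof.
move=> irr; rewrite /pdet /qdet -detZ; congr (\det _).
apply/matrixP => i j; rewrite !mxE /=; case: eqVneq => [->|_] /=.
  by rewrite irr !mulr1n mulr0n; ring.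
by case: (@edge G i j); rewrite /= ?mulr1n !mulr0n; ring.
Qed.

Lemma qdet_compl G z : irreflexive (edge (p := G)) ->
  qdet (pcompl G) z = (-1) ^+ order G * pdet G (- 1 - z).
Proof.
move=> irr; rewrite /pdet /qdet -detZ; congr (\det _).
apply/matrixP => i j; rewrite !mxE /=; case: eqVneq => [->|_] /=.
  by rewrite irr !mulr1n mulr0n; ring.
by case: (@edge G i j); rewrite /= ?mulr1n !mulr0n; ring.
Qed.

Lemma pmx_union G H : pmx (punion G H) = block_mx (pmx G) 0 0 (pmx H).
Proof.
apply/matrixP => i j; case: (split_ordP i) (split_ordP j) => a -> [] c ->;
  by rewrite ?block_mxEul ?block_mxEur ?block_mxEdl ?block_mxEdr !mxE /=
    ?split_lshift ?split_rshift.
Qed.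

Lemma det_schur1 n (M : 'M[K]_n) (u : 'rV_n) (v : 'cV_n) :
  \det (block_mx (1%:M : 'M_1) u v M) = \det (M - v *m u).
Proof.
have -> : block_mx (1%:M : 'M_1) u v M
    = block_mx 1%:M 0 v 1%:M *m block_mx 1%:M u 0 (M - v *m u).
  by rewrite mulmx_block !(mul1mx, mul0mx, mulmx1, mulmx0, addr0) addrC subrK.
by rewrite det_mulmx det_lblock det_ublock !det1 !mul1r.
Qed.

(* The determinants are Schur complements of bordered ones; the border row [(1, u, w)] is split as
   [(1, u, 0) + (1, 0, w) - (1, 0, 0)]. *)
Lemma det_block_sub_rank1 m n (M : 'M[K]_m) (N : 'M[K]_n)
    (u : 'rV_m) (w : 'rV_n) (v : 'cV_m) (x : 'cV_n) :
  \det (block_mx M 0 0 N - col_mx v x *m row_mx u w)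
  = \det (M - v *m u) * \det N + \det M * \det (N - x *m w) - \det M * \det N.
Proof.
pose rows c u' w' : 'M_(1 + (m + n)) :=
  col_mx (row_mx (c%:M : 'M_1) (row_mx u' w')) (row_mx (col_mx v x) (block_mx M 0 0 N)).
pose B u' w' := block_mx (1%:M : 'M_1) (row_mx u' w') (col_mx v x) (block_mx M 0 0 N).
pose i0 : 'I_(1 + (m + n)) := lshift (m + n) (0 : 'I_1).
have row_rows c u' w' : row i0 (rows c u' w') = row_mx c%:M (row_mx u' w').
  by rewrite /i0 /rows rowKu row_id.
have row'_rows c d u' w' u2 w2 : row' i0 (rows c u' w') = row' i0 (rows d u2 w2).
  apply/matrixP => i j; rewrite /rows !mxE.
  have -> : lift i0 i = rshift 1 i by apply: val_inj.
  by rewrite !(split_rshift, mxE).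
have det_rows u1 w1 u2 w2 : \det (rows 2 (u1 + u2) (w1 + w2)) = \det (B u1 w1) + \det (B u2 w2).
  rewrite -[\det (B u1 w1)]mul1r -[\det (B u2 w2)]mul1r.
  apply: (@determinant_multilinear _ _ _ (rows 1 u1 w1) (rows 1 u2 w2) i0);
    rewrite ?row_rows ?(row'_rows 2 1 _ _ u1 w1) ?(row'_rows 2 1 _ _ u2 w2) //.
  by rewrite !scale1r !add_row_mx -[in RHS](raddfD (@scalar_mx K 1)).
have E : \det (B u w) + \det (B 0 0) = \det (B u 0) + \det (B 0 w).
  by rewrite -!det_rows !addr0 add0r.
have BE u' w' : \det (B u' w') =
    \det (block_mx (M - v *m u') (- (v *m w')) (- (x *m u')) (N - x *m w')).
  by rewrite /B det_schur1 mul_col_row opp_block_mx add_block_mx !add0r.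
move: E; rewrite {1}/B det_schur1 !BE !mulmx0 !oppr0 !addr0.
rewrite !det_lblock !det_ublock => E.
exact: canRL (addrK _) E.
Qed.

Lemma pdet_union G H z : pdet (punion G H) z = pdet G z * pdet H z.
Proof.
rewrite /pdet pmx_union scalar_mx_block opp_block_mx add_block_mx !oppr0 !addr0.
by rewrite det_ublock.
Qed.

(** The all-ones matrix is a product of a column and a row, so this is a rank one perturbation of a
    block diagonal matrix. *)
Lemma qdet_union G H z :
  qdet (punion G H) z = qdet G z * pdet H z + pdet G z * qdet H z - pdet G z * pdet H z.
Proof.
have J m n : const_mx 1 = - ((- const_mx 1 : 'cV[K]_m) *m (const_mx 1 : 'rV[K]_n)).
  by rewrite mulNmx opprK; apply/matrixP => i j; rewrite !mxE big_ord1 !mxE mulr1.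
rewrite /qdet /pdet pmx_union scalar_mx_block opp_block_mx add_block_mx !oppr0 !addr0.
rewrite (J (order G + order H)%N) -col_mx_const opp_col_mx -[X in _ *m X]row_mx_const.
by rewrite det_block_sub_rank1 -!J.
Qed.
End Determinants.

(** * Cospectral cotrees *)

Section CospectralCotrees.
Local Open Scope ring_scope.

Definition pq_join (K : comNzRingType) (x y : K * K) : K * K :=
  (x.1 * y.1, x.2 * y.1 + x.1 * y.2 - x.1 * y.1).

(* The pair [(det (z - A), det (z - A + J))] of the graph realizing [t]. *)
Fixpoint pq (K : comNzRingType) t (z : K) : K * K :=
  let: Node s := t in
  if s is [::] then (z, z + 1) else
  foldr (fun u => let: (p, q) := pq u (- 1 - z) in
                  let c := (-1) ^+ leaves u in pq_join (c * q, c * p)) (1, 1) s.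

Lemma pqE (K : comNzRingType) t (z : K) :
  pq t z = (pdet (realize t) z, qdet (realize t) z).
Proof.
elim/cotree_ind_mem: t z => s IH z; have [->|sN0] := eqVneq s [::].
  rewrite /= /pdet /qdet !det_mx11 !mxE /= mulr1n; congr pair; ring.
rewrite realize_Node //.
have -> : pq (Node s) z = foldr (fun u => let: (p, q) := pq u (- 1 - z) in
    let c := (-1) ^+ leaves u in pq_join (c * q, c * p)) (1, 1) s.
  by case: (s) sN0.
elim: s IH {sN0} => [|t s IHs] IH /=; first by rewrite /pdet /qdet !det_mx00.
rewrite IHs; last by move=> u us; apply: IH; rewrite inE us orbT.
rewrite IH ?mem_head // /pq_join /=.
rewrite pdet_union qdet_union !pdet_compl ?qdet_compl ?order_realize //;
  exact: edge_realize_irr.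
Qed.

(** Quantifying over all polynomials makes the relation stable under the passage from [z] to
    [- 1 - z] at every level, and ['X] recovers characteristic polynomials. Leaf counts enter
    through the signs. *)
Definition cospectral t u :=
  leaves t = leaves u /\ forall z : {poly algC}, pq t z = pq u z.

Lemma cospectral_Node s1 t u s2 :
  cospectral t u -> cospectral (Node (s1 ++ t :: s2)) (Node (s1 ++ u :: s2)).
Proof.
case=> tu pqtu; split; first by rewrite !leaves_Node ?map_cat ?sumn_cat //= ?tu //; case: s1.
move=> z.
have E v : pq (Node (s1 ++ v :: s2)) z = foldr (fun u => let: (p, q) := pq u (- 1 - z) in
    let c := (-1) ^+ leaves u in pq_join (c * q, c * p)) (1, 1) (s1 ++ v :: s2).
  by case: s1.
by rewrite !E !foldr_cat /= pqtu tu.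
Qed.

Lemma det_reindex (K : comNzRingType) m n (f : 'I_m -> 'I_n) (M : 'M[K]_n) :
  m = n -> injective f -> \det (\matrix_(i, j) M (f i) (f j)) = \det M.
Proof.
move=> mn; subst m => fI; pose s := perm fI.
have -> : \matrix_(i, j) M (f i) (f j) = perm_mx s *m M *m perm_mx s^-1.
  rewrite -row_permE -col_permE; apply/matrixP => i j.
  by rewrite !mxE !permE.
rewrite !det_mulmx !det_perm odd_permV mulrAC -signr_addb addbb mul1r //.
Qed.

Lemma pq_rep n (e : rel 'I_n) t (z : {poly algC}) : symmetric e -> irreflexive e ->
  rep e t false setT ->
  pq t z = (\det (z%:M - \matrix_(i, j) (e i j)%:R),
            \det (z%:M - \matrix_(i, j) (e i j)%:R + const_mx 1)).
Proof.
move=> e_sym e_irr rt; have [f [fI fT fe]] := rep_embed e_sym rt.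
have on : order (realize t) = n.
  by rewrite order_realize -(rep_card rt) cardsT card_ord.
rewrite pqE /pdet /qdet.
by rewrite -(det_reindex (z%:M - _) on fI) -(det_reindex (_ + const_mx 1) on fI);
  congr pair; congr (\det _); apply/matrixP => i j; rewrite !mxE (inj_eq fI);
  (have [->|ij] := eqVneq i j; first by rewrite e_irr edge_realize_irr);
  rewrite fe // addbF.
Qed.

Lemma cospectral_canon t : cospectral t (canon t).
Proof.
split; first by rewrite leaves_canon.
have s := @edge_realize_sym t; have i := @edge_realize_irr t.
move=> z; have r := rep_realize t.
by rewrite (pq_rep z s i r) (pq_rep z s i (rep_canon s r)).
Qed.
End CospectralCotrees.

(** * From cotrees to labelled graphs *)

Section Graphs.
Variable n : nat.
Implicit Types g h : graph n.

Lemma simple_sym g : simple_graph g -> symmetric (adj g).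
Proof. by case/andP=> _ /forallP H i j; have /forallP/(_ j)/eqP := H i. Qed.

Lemma simple_irr g : simple_graph g -> irreflexive (adj g).
Proof. by case/andP=> /forallP H _ i; apply/negbTE. Qed.

Lemma adj_compl g i j : adj (compl_graph g) i j = (i != j) && ~~ adj g i j.
Proof. by rewrite /adj inE. Qed.

Lemma simple_compl g : simple_graph g -> simple_graph (compl_graph g).
Proof.
move=> sg; apply/andP; split; apply/forallP => i; first by rewrite adj_compl eqxx.
by apply/forallP => j; rewrite !adj_compl (eq_sym i) (simple_sym sg).
Qed.

Lemma rep_compl_graph g t b :
  rep (adj g) t b setT -> rep (adj (compl_graph g)) t (~~ b) setT.
Proof.
move=> /(rep_imset (e' := adj (compl_graph g)) (f := id) (d := true)).
rewrite imset_id addbT; apply=> // x y xy.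
by rewrite adj_compl xy addbT.
Qed.

Lemma char_poly_rep g t : simple_graph g -> rep (adj g) t false setT ->
  char_poly (adj_mx g) = (pq t ('X : {poly algC}))%R.1.
Proof.
move=> sg rg; rewrite (pq_rep _ (simple_sym sg) (simple_irr sg) rg) /=.
rewrite /char_poly /char_poly_mx; congr ((\det (_ - _))%R); apply/matrixP => i j.
by rewrite !mxE; case: adj; rewrite ?polyC1 ?polyC0.
Qed.

Lemma char_poly_compl_rep g t : simple_graph g -> rep (adj g) t false setT ->
  char_poly (adj_mx (compl_graph g)) = ((-1) ^+ n * (pq t (- 1 - 'X : {poly algC})).2)%R.
Proof.
move=> sg rg; rewrite (pq_rep _ (simple_sym sg) (simple_irr sg) rg) /=.
rewrite -detZ /char_poly /char_poly_mx; congr ((\det _)%R); apply/matrixP => i j.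
rewrite !mxE adj_compl.
have [->|_] := eqVneq i j; first by rewrite (simple_irr sg) !(mulr1n, mulr0n, polyC0); ring.
by case: (adj g i j); rewrite /= !(mulr1n, mulr0n, polyC0, polyC1); ring.
Qed.

(** A join root is reduced to a union root by complementing both graphs, which exchanges the two
    spectra. *)
Lemma cospectral_graphs g h t u b : simple_graph g -> simple_graph h ->
  rep (adj g) t b setT -> rep (adj h) u b setT -> cospectral t u ->
  gen_cospectral g h.
Proof.
have main g' h' : simple_graph g' -> simple_graph h' ->
    rep (adj g') t false setT -> rep (adj h') u false setT -> cospectral t u ->
    Spec g' = Spec h' /\ Spec (compl_graph g') = Spec (compl_graph h').
  move=> sg sh rg rh [_ pqE].
  by split; apply/funext => x; rewrite /Spec ?(char_poly_rep sg rg) ?(char_poly_rep sh rh)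
    ?(char_poly_compl_rep sg rg) ?(char_poly_compl_rep sh rh) pqE.
move=> sg sh rg rh tu; case: b rg rh => rg rh; last exact: main.
have complK (k : graph n) : simple_graph k -> compl_graph (compl_graph k) = k.
  move=> sk; apply/setP => -[i j]; rewrite !inE /= negb_and !negbK.
  by have [->|] := eqVneq i j; rewrite //= -/(adj k j j) (simple_irr sk).
have := main _ _ (simple_compl sg) (simple_compl sh) (rep_compl_graph rg) (rep_compl_graph rh) tu.
by rewrite !complK // => -[].
Qed.

Lemma graph_iso_rep g h t b : simple_graph g -> simple_graph h ->
  rep (adj g) t b setT -> rep (adj h) t b setT -> graph_iso g h.
Proof.
move=> sg sh rg rh.
have [f [fI fT fe]] := rep_embed (simple_sym sg) rg.
have [f' [fI' fT' fe']] := rep_embed (simple_sym sh) rh.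
have inv i : {j | f j = i}.
  apply: cid; have : i \in f @: setT by rewrite fT inE.
  by case/imsetP=> j _ ->; exists j.
pose k i := sval (inv i); have kK i : f (k i) = i := svalP (inv i).
have kI : injective (f' \o k).
  by move=> i j /fI' E; rewrite -(kK i) -(kK j) E.
apply/existsP; exists (perm kI); apply/forallP => i; apply/forallP => j.
rewrite !permE /=; have [->|ij] := eqVneq i j.
  by rewrite (simple_irr sg) (simple_irr sh).
have kij : k i != k j by apply: contraNneq ij => E; rewrite -(kK i) -(kK j) E.
by rewrite fe' // -fe // !kK.
Qed.

Lemma rep_graph_iso g h t b : graph_iso g h ->
  rep (adj g) t b setT -> rep (adj h) t b setT.
Proof.
case/existsP=> s /forallP H rg.
have -> : [set: 'I_n] = s @: setT.
  by apply/setP => i; rewrite inE; apply/esym/imsetP; exists (s^-1 i)%g; rewrite ?permKV.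
rewrite -(addbF b); apply: rep_imset rg; first exact: perm_inj.
by move=> x y _; rewrite addbF; have /forallP/(_ y)/eqP := H x.
Qed.

Lemma graph_iso_refl g : graph_iso g g.
Proof.
by apply/existsP; exists 1%g; apply/forallP => i; apply/forallP => j; rewrite !perm1.
Qed.

Lemma graph_iso_sym g h : graph_iso g h -> graph_iso h g.
Proof.
case/existsP=> s /forallP H; apply/existsP; exists (s^-1)%g.
apply/forallP => i; apply/forallP => j.
have /forallP/(_ (s^-1 j)%g)/eqP -> := H (s^-1 i)%g.
by rewrite !permKV.
Qed.

Lemma graph_iso_trans g h k : graph_iso g h -> graph_iso h k -> graph_iso g k.
Proof.
case/existsP=> s /forallP H /existsP[s' /forallP H']; apply/existsP; exists (s * s')%g.
apply/forallP => i; apply/forallP => j; rewrite !permM.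
have /forallP/(_ j)/eqP -> := H i; exact: (forallP (H' (s i))).
Qed.

Lemma cograph_exists_rep g : 0 < n -> cograph g ->
  exists t b, wf t /\ rep (adj g) t b setT.
Proof.
move=> n0 /andP[sg F].
have F0 : P4_free (adj g) setT false.
  move=> x y z w _ _ _ _ [U [[xy yz zw] [xz xw yw]]].
  have /forallP/(_ y)/forallP/(_ z)/forallP/(_ w)/negP := forallP F x.
  by apply; rewrite /induced_P4 U xy yz zw xz xw yw.
apply: (rep_exists (simple_sym sg)).
  by rewrite -card_gt0 cardsT card_ord.
by case=> //; apply: (P4_freeN (simple_sym sg) F0).
Qed.

Lemma cograph_rep g t b : simple_graph g -> rep (adj g) t b setT -> cograph g.
Proof.
move=> sg rg; rewrite /cograph sg /=.
have := rep_P4_free (simple_sym sg) rg.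
have F : P4_free (adj g) setT b -> P4_free (adj g) setT false.
  by case: (b) => // /(P4_freeN (simple_sym sg)).
move/F=> {}F; do 4![apply/forallP => ?]; apply/negP.
case/and5P=> U xy yz zw /and3P[/negbTE xz /negbTE xw /negbTE yw].
by apply: F (conj U (conj (And3 xy yz zw) (And3 xz xw yw))); rewrite inE.
Qed.

Lemma graph_of_cotree t b : leaves t = n ->
  exists2 g : graph n, simple_graph g & rep (adj g) t b setT.
Proof.
rewrite -order_realize => on; pose f := cast_ord (esym on).
pose g : graph n := [set p : 'I_n * 'I_n |
  (p.1 != p.2) && (edge (p := realize t) (f p.1) (f p.2) (+) b)].
have adjE i j : adj g i j = (i != j) && (edge (f i) (f j) (+) b) by rewrite /adj inE.
exists g.
  apply/andP; split; apply/forallP => i; first by rewrite adjE eqxx.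
  by apply/forallP => j; rewrite !adjE (eq_sym i) edge_realize_sym.
have -> : [set: 'I_n] = cast_ord on @: setT.
  by apply/setP => i; rewrite inE; apply/esym/imsetP; exists (f i); rewrite ?cast_ordKV.
have := rep_realize t; move/rep_imset => /(_ _ _ (cast_ord on) b (@cast_ord_inj _ _ _)).
rewrite addFb; apply=> x y xy.
by rewrite adjE /f !cast_ordK (inj_eq (@cast_ord_inj _ _ _)) xy.
Qed.
End Graphs.

(** * A pair of cospectral cotrees *)

Definition leaf := Node [::].
Definition star2 := Node [:: leaf; leaf].

(* Found by computer search. *)
Definition mate1 :=
  Node [:: Node [:: Node [:: Node [:: star2; star2; leaf]; Node [:: star2; leaf]]; star2];
           Node [:: Node [:: leaf; leaf; leaf; leaf]; leaf]].

Definition mate2 :=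
  Node [:: Node [:: Node [:: Node [:: Node [:: leaf; leaf; leaf; leaf]; star2; leaf];
                             Node [:: star2; leaf]]; leaf];
           Node [:: star2; star2]].

Lemma pq_mates (K : comNzRingType) (z : K) : pq mate1 z = pq mate2 z.
Proof. rewrite /= /pq_join /=. congr pair. ring. ring. Qed.

Lemma cospectral_mates : cospectral mate1 mate2.
Proof. by split=> // z; exact: pq_mates. Qed.

(** * Isomorphism classes of cographs *)

Definition canonical t := wf t && (canon t == t).

Fixpoint occurs u t : bool :=
  let: Node s := t in (Node s == u) || has (occurs u) s.

Lemma canon_NodeP s s' :
  reflect (canon (Node s) = canon (Node s')) (perm_eq (map canon s) (map canon s')).
Proof.
have sortP := perm_sortP cotree_le_total cotree_le_trans cotree_le_anti.
by apply: (iffP idP) => [/sortP E | [/sortP]] //=; rewrite E.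
Qed.

Lemma canonicalP s : reflect [/\ size s != 1, all canonical s & sorted cotree_le s]
  (canonical (Node s)).
Proof.
apply: (iffP andP) => [[/= /andP[s1 ws] /eqP[E]]|[s1 cs ss]].
  split=> //; last by rewrite -E sort_sorted //; exact: cotree_le_total.
  apply/allP => t ts; rewrite /canonical (allP ws) //=.
  by move: ts; rewrite -E mem_sort => /mapP[u _ ->]; rewrite canon_id.
have cE : map canon s = s.
  by rewrite -[RHS]map_id; apply/eq_in_map => t /(allP cs)/andP[_ /eqP].
rewrite /= s1 cE sorted_sort //; last exact: cotree_le_trans.
by split=> //; apply/allP => t /(allP cs)/andP[].
Qed.

Lemma canonical_canon t : wf t -> canonical (canon t).
Proof. by move=> wt; rewrite /canonical wf_canon //= canon_id. Qed.

(** An invariant that separates the mates without computing canonical forms: the children of their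
    roots have 10 and 5 leaves in one, 11 and 4 in the other. *)
Lemma canon_Node_leaves s s' :
  canon (Node s) = canon (Node s') -> perm_eq (map leaves s) (map leaves s').
Proof.
move/canon_NodeP/(perm_map leaves); rewrite -!map_comp.
by rewrite !(eq_map (g := leaves)) // => t /=; rewrite leaves_canon.
Qed.

Lemma canonical_mates s s' : wf (Node s) -> wf (Node s') -> 1 < leaves (Node s) ->
  ~~ perm_eq (map leaves s') (map leaves s) -> cospectral (Node s) (Node s') ->
  exists p q, [/\ canonical p, 1 < leaves p, wf q, canon q != p & cospectral p q].
Proof.
move=> ws ws' l1 ss' [l2 E2]; have [l3 E3] := cospectral_canon (Node s).
exists (canon (Node s)), (Node s'); split=> //.
- exact: canonical_canon.
- by rewrite leaves_canon.
- by apply: contra ss' => /eqP; exact: canon_Node_leaves.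
by split; [rewrite -l3 | move=> z; rewrite -E3].
Qed.

Lemma exists_mates : exists p q,
  [/\ canonical p, 1 < leaves p, wf q, canon q != p & cospectral p q].
Proof.
have H ws ws' l1 ss' := canonical_mates ws ws' l1 ss' cospectral_mates.
exact: H isT isT isT isT.
Qed.

(** * Substitution of mates and counting of classes *)

Section Mates.
Variables p q : cotree.
Hypotheses (wf_q : wf q) (canon_q : canon q != p) (pq_cospectral : cospectral p q).

(** Induction down to an occurrence of [p]. Replacing one child by a tree with another canonical
    form changes the multiset of canonical children, so the difference survives up to the root. *)
Lemma mate_exists t : canonical t -> occurs p t ->
  exists u, [/\ wf u, canon u != t & cospectral t u].
Proof.
elim/cotree_ind_mem: t => s IH ct; rewrite [occurs _ _]/= => /orP[/eqP->|].
  by exists q.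
case/hasP=> t ts ot; have /canonicalP[s1 cs ss] := ct.
have [u [wu cu tu]] := IH t ts (allP cs _ ts) ot.
case/path.splitPr: s / ts IH ct s1 cs ss => r1 r2 IH ct s1 cs ss.
exists (Node (r1 ++ u :: r2)); split; last exact: cospectral_Node.
  have [/= + _] := andP ct; rewrite !size_cat !all_cat /= wu.
  by case/and4P=> -> -> _ ->.
have [_ /eqP {1}<-] := andP ct; rewrite eq_sym.
apply: contra cu => /eqP/canon_NodeP.
rewrite !map_cat perm_cat2l /= -!(cat1s _ (map canon r2)) perm_cat2r.
move=> pe; have [<-] := perm_small_eq (isT : size [:: canon u] <= 1) pe.
by move: cs; rewrite all_cat /= => /and3P[_ /andP[]].
Qed.

Section Counting.
Variable n : nat.
Hypothesis n_gt0 : 0 < n.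

Definition has_mate (C : {set graph n}) : bool :=
  `[< exists G H : graph n, [/\ G \in C, cograph H, ~~ graph_iso G H
                               & gen_cospectral G H] >].

Lemma h_numE : h_num n = #|[set C in cograph_classes n | has_mate C]|.
Proof. by []. Qed.

Lemma cograph_classP (C : {set graph n}) : reflect
  (exists2 g : graph n, cograph g & C = [set h | cograph h & graph_iso g h])
  (C \in cograph_classes n).
Proof.
have E (g : graph n) : [set y in cographs n | graph_iso g y] = [set h | cograph h & graph_iso g h].
  by apply/setP => h; rewrite !inE.
apply: (iffP imsetP) => [[g]|[g cg ->]]; first by rewrite inE E; exists g.
by exists g; rewrite ?inE // E.
Qed.

Lemma cograph_class_eq (C D : {set graph n}) g h :
  C \in cograph_classes n -> D \in cograph_classes n ->
  g \in C -> h \in D -> graph_iso g h -> C = D.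
Proof.
case/cograph_classP=> g' _ ->; case/cograph_classP=> h' _ ->.
rewrite !inE => /andP[_ g'g] /andP[_ h'h] gh; apply/setP => k; rewrite !inE.
congr (_ && _); apply/idP/idP => [g'k|h'k].
  apply: graph_iso_trans h'h _; apply: graph_iso_trans (graph_iso_sym gh) _.
  exact: graph_iso_trans (graph_iso_sym g'g) _.
apply: graph_iso_trans g'g _; apply: graph_iso_trans gh _.
exact: graph_iso_trans (graph_iso_sym h'h) _.
Qed.

Lemma cograph_class_rep C : C \in cograph_classes n ->
  exists t b g, [/\ canonical t, g \in C, simple_graph g & rep (adj g) t b setT].
Proof.
case/cograph_classP=> g cg ->; have [t [b [wt rt]]] := cograph_exists_rep n_gt0 cg.
have sg : simple_graph g by case/andP: cg.
exists (canon t), b, g; split=> //; first exact: canonical_canon.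
  by rewrite inE cg graph_iso_refl.
exact: (rep_canon (simple_sym sg) rt).
Qed.

Lemma rep_leaves (g : graph n) t b : rep (adj g) t b setT -> leaves t = n.
Proof. by move/rep_card <-; rewrite cardsT card_ord. Qed.

(** The mate is realized with the same root type [b]; an isomorphism would let [t] and [u] represent
    the same graph, against uniqueness of cotrees. *)
Lemma has_mate_occurs C t b g : C \in cograph_classes n ->
  [/\ canonical t, g \in C, simple_graph g & rep (adj g) t b setT] ->
  occurs p t -> has_mate C.
Proof.
move=> CC [ct gC sg rg] ot; have [u [wu ut tu]] := mate_exists ct ot.
have [h sh rh] := @graph_of_cotree n u b (etrans (esym tu.1) (rep_leaves rg)).
apply/asboolP; exists g, h; split=> //; first exact: cograph_rep rh.
  apply: contra ut => /rep_graph_iso/(_ rg) rh'.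
  have [wt /eqP tE] := andP ct.
  by rewrite (rep_uniq (simple_sym sh) wu wt rh rh') tE.
exact: cospectral_graphs rg rh tu.
Qed.

(** A class without a mate has a cotree that avoids [p], so these classes inject into pairs of such
    a cotree and a root type, whence the factor 2. *)
Lemma card_mateless_le (F : seq cotree) :
  (forall t, canonical t -> leaves t = n -> ~~ occurs p t -> t \in F) ->
  c_num n - h_num n <= 2 * size F.
Proof.
move=> FP; rewrite h_numE /c_num -(cardsID [set C | has_mate C] (cograph_classes n)).
have -> : cograph_classes n :&: [set C | has_mate C]
    = [set C in cograph_classes n | has_mate C].
  by apply/setP => C; rewrite !inE.
rewrite addKn; set M := _ :\: _.
have H C : exists r : cotree * bool, C \in M -> r \in [seq (t, b) | t <- F, b <- [:: true; false]]
    /\ exists2 g, g \in C & simple_graph g /\ rep (adj g) r.1 r.2 setT.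
  (* Sets outside [M] get a dummy value, so that a total choice function exists. *)
  have [|] := boolP (C \in M); last by exists (leaf, false).
  rewrite !inE => /andP[nC CC]; have [t [b [g gP]]] := cograph_class_rep CC.
  exists (t, b) => _; have [ct gC sg rg] := gP; split; last by exists g.
  apply/allpairsP; exists (t, b); split=> //=; last by case: (b).
  apply: FP => //; first exact: rep_leaves rg.
  by apply: contra nC; exact: has_mate_occurs gP.
have [f fP] := choice H.
have fI : {in M &, injective f}.
  move=> C D CM DM E; have [_ [g gC [sg rg]]] := fP C CM.
  have [_ [h hD [sh rh]]] := fP D DM.
  have [/setDP[CC _] /setDP[DC _]] := (CM, DM).
  by apply: cograph_class_eq CC DC gC hD _; rewrite -E in rh; exact: graph_iso_rep rg rh.
have -> : 2 * size F = size [seq (t, b) | t <- F, b <- [:: true; false]].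
  by rewrite size_allpairs mulnC.
rewrite cardE -(size_map f); apply: uniq_leq_size.
  rewrite map_inj_in_uniq ?enum_uniq // => C D; rewrite !mem_enum; exact: fI.
by move=> r /mapP[C]; rewrite mem_enum => CM ->; case: (fP C CM).
Qed.

(** Union roots suffice: distinct canonical cotrees with this root type give non-isomorphic
    graphs. *)
Lemma card_classes_ge (L : seq cotree) : uniq L ->
  {in L, forall t, canonical t /\ leaves t = n} -> size L <= c_num n.
Proof.
move=> uL LP.
have H t : exists C, t \in L -> C \in cograph_classes n /\
    exists2 g, g \in C & simple_graph g /\ rep (adj g) t false setT.
  have [tL|] := boolP (t \in L); last by exists set0.
  have [ct lt] := LP t tL; have [g sg rg] := graph_of_cotree false lt.
  have cg := cograph_rep sg rg.
  exists [set h | cograph h & graph_iso g h] => _; split.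
    by apply/cograph_classP; exists g.
  by exists g => //; rewrite inE cg graph_iso_refl.
have [f fP] := choice H.
rewrite /c_num cardE -(size_map f); apply: uniq_leq_size.
  rewrite map_inj_in_uniq // => t u tL uL' E.
  have [CC [g gC [sg rg]]] := fP t tL; have [DC [h hD [sh rh]]] := fP u uL'.
  rewrite -E in hD; move/cograph_classP: CC gC hD => [k _ ->]; rewrite !inE.
  move=> /andP[_ kg] /andP[_ kh].
  have gh := graph_iso_trans (graph_iso_sym kg) kh.
  have [[/andP[wt /eqP <-] _] [/andP[wu /eqP <-] _]] := (LP t tL, LP u uL').
  exact: (rep_uniq (simple_sym sh) wt wu (rep_graph_iso gh rg) rh).
by move=> C /mapP[t tL ->]; rewrite mem_enum; case: (fP t tL).
Qed.

Lemma h_num_le : h_num n <= c_num n.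
Proof. by rewrite h_numE /c_num subset_leq_card //; apply/subsetP => C; rewrite inE => /andP[]. Qed.
End Counting.
End Mates.

(** * Enumeration of cotrees *)

Definition weight (s : seq cotree) := sumn (map leaves s).

Lemma size_le_weight s : size s <= weight s.
Proof.
by elim: s => //= t s IH; rewrite -add1n leq_add ?leaves_gt0.
Qed.

Lemma leaves_le_weight s t : t \in s -> leaves t <= weight s.
Proof.
case/path.splitPr=> s1 s2.
by rewrite /weight map_cat sumn_cat /= addnCA leq_addr.
Qed.

Lemma leaves_lt_weight s t : t \in s -> 1 < size s -> leaves t < weight s.
Proof.
case/path.splitPr=> s1 s2; rewrite size_cat /= addnS ltnS => s0.
rewrite /weight map_cat sumn_cat /= addnCA -{1}(addn0 (leaves t)) ltn_add2l.
by apply: leq_trans s0 _; apply: leq_add; exact: size_le_weight.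
Qed.

(* The sorted multisets over [L] with all multiplicities at most [J], for a
   sorted duplicate-free list [L]. *)
Fixpoint msets J (L : seq cotree) : seq (seq cotree) :=
  if L is t :: L' then [seq nseq j t ++ s | j <- iota 0 J.+1, s <- msets J L']
  else [:: [::]].

Lemma msets_consP J t L s : reflect
  (exists j r, [/\ (j <= J), r \in msets J L & s = nseq j t ++ r]) (s \in msets J (t :: L)).
Proof.
apply: (iffP allpairsP) => [[[j r] /= [jJ rL ->]]|[j [r [jJ rL ->]]]].
  by exists j, r; rewrite -ltnS; move: jJ; rewrite (mem_iota 0 J.+1).
by exists (j, r); rewrite (mem_iota 0 J.+1).
Qed.

Lemma msets_sub J L s : s \in msets J L -> {subset s <= L}.
Proof.
elim: L s => [|t L IH] s; first by rewrite inE => /eqP->.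
case/msets_consP=> j [r [_ rL ->]] u; rewrite mem_cat mem_nseq inE.
by case/orP=> [/andP[_ ->] //|/(IH _ rL) ->]; rewrite orbT.
Qed.

Lemma sorted_msets J L s : sorted cotree_le L -> s \in msets J L -> sorted cotree_le s.
Proof.
elim: L s => [|t L IH] s; first by move=> _; rewrite inE => /eqP->.
rewrite [sorted _ _]/= path_sortedE; last exact: cotree_le_trans.
case/andP=> /allP tL sL /msets_consP[j [r [_ rL ->]]].
elim: j => [|j IHj] /=; first exact: IH.
rewrite path_sortedE; last exact: cotree_le_trans.
rewrite IHj andbT; apply/allP => u; rewrite mem_cat mem_nseq => /orP[/andP[_ /eqP->]|].
  exact: leqnn.
by move/(msets_sub rL)/tL.
Qed.

Lemma mem_msets J L s : uniq L -> sorted cotree_le L -> sorted cotree_le s ->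
  {subset s <= L} -> size s <= J -> s \in msets J L.
Proof.
elim: L s => [|t L IH] s.
  by move=> _ _ _; case: s => // u s sub; have := sub u (mem_head _ _).
case/andP=> tL uL; rewrite [sorted _ (_ :: _)]/= path_sortedE; last exact: cotree_le_trans.
case/andP=> /allP tle sL ss sub sJ.
(* As [t] is least in [t :: L], its copies come first in the sorted list [s]. *)
have sE : s = nseq (count_mem t s) t ++ filter (predC1 t) s.
  have fE : nseq (count_mem t s) t = filter (pred1 t) s.
    by rewrite -size_filter; apply/esym/all_pred1P; exact: filter_all.
  apply: (sorted_eq cotree_le_trans cotree_le_anti) => //.
    have sf : sorted cotree_le (filter (predC1 t) s).
      exact: (sorted_filter cotree_le_trans).
    elim: count => [|k IHk] //=; rewrite path_sortedE; last exact: cotree_le_trans.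
    rewrite IHk andbT; apply/allP => u; rewrite mem_cat mem_nseq mem_filter.
    case/orP=> [/andP[_ /eqP->]|/andP[/= ut /sub]]; first exact: leqnn.
    by rewrite inE (negbTE ut) => /tle.
  by rewrite fE perm_sym perm_filterC.
rewrite sE; apply/msets_consP; exists (count_mem t s), (filter (predC1 t) s); split=> //.
  by rewrite (leq_trans (count_size _ _)).
apply: IH => //; first exact: (sorted_filter cotree_le_trans).
  by move=> u; rewrite mem_filter => /andP[/= ut /sub]; rewrite inE (negbTE ut).
by rewrite size_filter (leq_trans (count_size _ _)).
Qed.

Lemma uniq_msets J L : uniq L -> uniq (msets J L).
Proof.
elim: L => [|t L IH] // /andP[tL uL]; apply: allpairs_uniq.
- exact: iota_uniq.
- exact: IH.
move=> [j r] [k s] /allpairsP[[j1 r1] [_ r1L [-> ->]]] /allpairsP[[k1 s1] [_ s1L [-> ->]]].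
move: r1L s1L => /= r1L s1L.
have count0 v : v \in msets J L -> count_mem t v = 0.
  by move/msets_sub=> vL; apply/count_memPn; apply: contra tL; exact: vL.
move=> E; have jk : j1 = k1.
  have := congr1 (count_mem t) E.
  by rewrite !count_cat !count_nseq !count0 //= eqxx !mul1n !addn0.
by move: E; rewrite jk => /eqP; rewrite eqseq_cat // eqxx => /eqP->.
Qed.

(** Lists the canonical cotrees with at most [N] leaves. Each of two or more children has fewer
    leaves than the whole, so it comes from [trees N']; multiplicities are at most [N] because leaf
    counts are positive. *)
Fixpoint trees N : seq cotree :=
  if N is N'.+1 then
    sort cotree_le
      (leaf :: [seq Node s | s <- msets N (trees N') & (1 < size s) && (weight s <= N)])
  else [::].

Lemma sorted_trees N : sorted cotree_le (trees N).
Proof. by case: N => //= N; apply: sort_sorted; exact: cotree_le_total. Qed.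

Lemma uniq_trees N : uniq (trees N).
Proof.
elim: N => //= N IH; rewrite sort_uniq /=; apply/andP; split.
  by apply/mapP => -[s]; rewrite mem_filter => /andP[/andP[+ _] _ [sE]]; rewrite -sE.
by rewrite map_inj_uniq ?filter_uniq ?uniq_msets // => s s' [].
Qed.

Lemma weight_leaves s : 1 < size s -> leaves (Node s) = weight s.
Proof. by case: s. Qed.

Lemma mem_trees N t : (t \in trees N) = canonical t && (leaves t <= N).
Proof.
elim: N t => [|N IH] t; first by rewrite leqn0 eqn0Ngt leaves_gt0 andbF.
rewrite [trees _]/= mem_sort inE; apply/orP/andP.
  case=> [/eqP->//|/mapP[s]]; rewrite mem_filter => /andP[/andP[s2 ws] sm ->].
  split; last by rewrite weight_leaves.
  apply/canonicalP; split; first by case: (size s) s2 => [|[]].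
    by apply/allP => u /(msets_sub sm); rewrite IH => /andP[].
  exact: sorted_msets (sorted_trees N) sm.
case: t => s [/canonicalP[s1 cs ss] lN]; have [->|sN0] := eqVneq s [::]; first by left.
have s2 : 1 < size s by case: (s) s1 sN0 => [|? []].
rewrite weight_leaves // in lN.
right; apply/map_f; rewrite mem_filter s2 lN /=.
apply: mem_msets (uniq_trees N) (sorted_trees N) ss _ (leq_trans (size_le_weight s) lN).
move=> u us; rewrite IH (allP cs) //= -ltnS.
exact: leq_trans (leaves_lt_weight us s2) lN.
Qed.

Arguments trees N : simpl never.

Lemma leaf_trees N : leaf \in trees N.+1.
Proof. by rewrite mem_trees. Qed.

Lemma mem_rem_leaf (L : seq cotree) t : uniq L ->
  (t \in rem leaf L) = (t != leaf) && (t \in L).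
Proof. by move=> uL; rewrite mem_rem_uniq // inE. Qed.

Lemma canonical_gt1 t : canonical t -> t != leaf -> 1 < size (children t).
Proof. by case/andP; case: t => -[|u [|v s]]. Qed.

Lemma weight_children t : 1 < size (children t) -> weight (children t) = leaves t.
Proof. by case: t => s /= /weight_leaves. Qed.

(** * Truncated generating functions and Euler products *)

Section Sums.
Variable R : realFieldType.
Local Open Scope ring_scope.
Implicit Type x : R.

Definition gf (L : seq cotree) x : R := \sum_(t <- L) x ^+ leaves t.

Lemma ler_sum_subset (I : eqType) (s1 s2 : seq I) (F : I -> R) : uniq s1 ->
  {subset s1 <= s2} -> (forall i, 0 <= F i) -> \sum_(i <- s1) F i <= \sum_(i <- s2) F i.
Proof.
move=> + + F0; elim: s1 s2 => [|a s1 IH] s2 /=; first by rewrite big_nil sumr_ge0.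
case/andP=> as1 us1 sub; have as2 := sub a (mem_head _ _).
rewrite big_cons (perm_big _ (perm_to_rem as2)) big_cons lerD2l.
apply: IH => // b bs1; have : b \in s2 by rewrite sub // inE bs1 orbT.
rewrite (perm_mem (perm_to_rem as2)) inE => /orP[/eqP ba|//].
by rewrite -ba bs1 in as1.
Qed.

Lemma sum_msets J L x : \sum_(s <- msets J L) x ^+ weight s
  = \prod_(t <- L) \sum_(j < J.+1) (x ^+ leaves t) ^+ j.
Proof.
elim: L => [|t L IH]; first by rewrite big_seq1 big_nil expr0.
rewrite big_cons -IH -[LHS]/(\sum_(s <- allpairs _ _ _) _) big_allpairs_dep.
rewrite -[iota 0 _]/(index_iota 0 J.+1) big_mkord big_distrl /=.
apply: eq_bigr => j _; rewrite big_distrr /=; apply: eq_bigr => s _.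
by rewrite /weight map_cat sumn_cat map_nseq sumn_nseq exprD exprM.
Qed.

(** Half of the Euler product identity, whose right side is [1 + T + (T - x)] for the full series
    [T]: a multiset of cotrees has no element, one, or at least two, and in the last case it is the
    child list of a cotree other than [leaf]. *)
Lemma prod_trees_le J N x : 0 <= x -> exists M, 
  \prod_(t <- trees N) \sum_(j < J.+1) (x ^+ leaves t) ^+ j
   <= 1 + gf (trees N) x + (gf (trees M) x - x).
Proof.
move=> x0; set S := msets J (trees N).
(* Large enough for every node whose children form a multiset in [S]. *)
pose M := (\max_(s <- S) weight s).+1; exists M; rewrite -sum_msets -/S.
pose S' := [::] :: [seq [:: t] | t <- trees N] ++ [seq children t | t <- rem leaf (trees M)].
have -> : 1 + gf (trees N) x + (gf (trees M) x - x) = \sum_(s <- S') x ^+ weight s.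
  rewrite big_cons big_cat !big_map /= -addrA expr0; congr (_ + (_ + _)).
    by apply: eq_bigr => t _; rewrite /weight /= addn0.
  rewrite /gf (perm_big _ (perm_to_rem (leaf_trees _))) big_cons /= expr1 addrAC subrr add0r.
  apply: eq_big_seq => t; rewrite mem_rem_leaf ?uniq_trees // mem_trees.
  by case/and3P=> tl ct _; rewrite weight_children // canonical_gt1.
apply: ler_sum_subset; first exact/uniq_msets/uniq_trees; last by move=> s; exact: exprn_ge0.
move=> s sS; have sub := msets_sub sS.
case: s sS sub => [|t [|u s]] sS sub; first by rewrite inE.
  rewrite inE mem_cat; apply/orP; right; apply/orP; left.
  by apply/map_f/sub; rewrite inE.
rewrite inE mem_cat; apply/orP; right; apply/orP; right.
apply/mapP; exists (Node [:: t, u & s]) => //.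
rewrite mem_rem_leaf ?uniq_trees //; apply/andP; split; first by apply/eqP.
rewrite mem_trees; apply/andP; split.
  apply/canonicalP; split=> //; last exact: sorted_msets (sorted_trees N) sS.
  by apply/allP => v /sub; rewrite mem_trees => /andP[].
rewrite weight_leaves //; apply: leqW.
by rewrite (big_rem _ sS) leq_maxl.
Qed.

Section Avoiding.
Variable p : cotree.
Hypotheses (cp : canonical p) (p_gt1 : (1 < leaves p)%N).

Definition avoiding N := [seq t <- trees N | ~~ occurs p t].

Lemma occurs_leaves t : occurs p t -> (leaves p <= leaves t)%N.
Proof.
elim/cotree_ind_mem: t => s IH /= /orP[/eqP<-//|/hasP[t ts ot]].
apply: leq_trans (IH t ts ot) _; by case: (s) ts => // u r ts; exact: leaves_le_weight ts.
Qed.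

(** The opposite inequality, for cotrees avoiding [p]: the empty multiset, the singletons, the child
    lists of avoiding cotrees and the children of [p] are distinct multisets of avoiding cotrees.
    The last one yields the slack. *)
Lemma avoiding_le N x : 0 <= x -> (leaves p <= N.+1)%N ->
  gf (avoiding N.+1) x + 1 + gf (avoiding N) x + x ^+ leaves p
  <= x + \prod_(t <- avoiding N) \sum_(j < N.+2) (x ^+ leaves t) ^+ j.
Proof.
move=> x0 pN; rewrite -sum_msets.
have uA M : uniq (avoiding M) by rewrite filter_uniq ?uniq_trees.
have size_children t : t \in rem leaf (avoiding N.+1) -> (1 < size (children t))%N.
  rewrite mem_rem_leaf // mem_filter mem_trees => /and4P[tl _ ct _].
  exact: canonical_gt1.
have p2 : (1 < size (children p))%N.
  by apply: canonical_gt1 => //; apply: contraTneq p_gt1 => ->.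
have sA : sorted cotree_le (avoiding N).
  by apply: sorted_filter (sorted_trees N); exact: cotree_le_trans.
have leafA : leaf \in avoiding N.+1.
  rewrite mem_filter leaf_trees andbT /= orbF; apply/eqP => E.
  by move: p_gt1; rewrite -E.
pose S := [::] :: [seq [:: t] | t <- avoiding N] ++
          children p :: [seq children t | t <- rem leaf (avoiding N.+1)].
have -> : gf (avoiding N.+1) x + 1 + gf (avoiding N) x + x ^+ leaves p
    = x + \sum_(s <- S) x ^+ weight s.
  have wp := weight_children p2.
  rewrite big_cons big_cat big_cons !big_map /= wp expr0.
  rewrite /gf (perm_big _ (perm_to_rem leafA)) big_cons /= expr1.
  have -> : \sum_(t <- avoiding N) x ^+ weight [:: t] = \sum_(t <- avoiding N) x ^+ leaves t.
    by apply: eq_bigr => t _; rewrite /weight /= addn0.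
  have -> : \sum_(t <- rem leaf (avoiding N.+1)) x ^+ weight (children t)
      = \sum_(t <- rem leaf (avoiding N.+1)) x ^+ leaves t.
    by apply: eq_big_seq => t /size_children; move=> t2; rewrite weight_children.
  by rewrite -!addrA; congr (_ + _); rewrite addrCA; congr (_ + _); rewrite addrCA;
     congr (_ + _); rewrite addrC.
rewrite lerD2l; apply: ler_sum_subset; last by move=> s; exact: exprn_ge0.
- rewrite cons_uniq cat_uniq cons_uniq.
  have inj1 : injective (fun t : cotree => [:: t]) by move=> t u [].
  have inj2 : injective children by move=> [s] [s'] /= ->.
  rewrite !map_inj_uniq ?rem_uniq ?uA // andbT /=; apply/and3P; split.
  + rewrite mem_cat inE; apply/norP; split; first by apply/mapP => -[].
    apply/norP; split; first by apply: contraTneq p2 => <-.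
    by apply/mapP => -[t /size_children + E]; rewrite -E.
  + apply/norP; split.
      by apply/mapP => -[t _ E]; rewrite E in p2.
    by apply/hasPn => s /mapP[t /size_children t2 ->]; apply/mapP => -[u _ E]; rewrite E in t2.
  + apply/mapP => -[t tA /inj2 pt]; move/mem_rem: tA; rewrite -pt mem_filter.
    by case: (p) => s /=; rewrite eqxx.
have inS t : t \in trees N.+1 -> (1 < size (children t))%N ->
    {in children t, forall u, ~~ occurs p u} -> children t \in msets N.+1 (avoiding N).
  rewrite mem_trees; case: t => s /andP[/canonicalP[s1 cs ss] + ] /= s2 av.
  rewrite -[X in (X <= _)%N]/(leaves (Node s)) weight_leaves // => wN.
  apply: mem_msets => //.
  - move=> u us; rewrite mem_filter av //= mem_trees (allP cs) //= -ltnS.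
    exact: leq_trans (leaves_lt_weight us s2) wN.
  - exact: leq_trans (size_le_weight s) wN.
move=> s; rewrite inE mem_cat inE => /or4P[/eqP->|/mapP[t tA ->]|/eqP->|/mapP[t tA ->]].
- by apply: mem_msets.
- apply: mem_msets => //.
  by move=> u; rewrite inE => /eqP->.
- apply: inS => //; first by rewrite mem_trees cp.
  move=> u us; apply/negP => /occurs_leaves.
  by rewrite leqNgt -(weight_children p2) leaves_lt_weight.
have tA' := mem_rem tA; move: tA'; rewrite mem_filter => /andP[ot tT].
apply: inS => //; first exact: size_children.
by move=> u us; apply: contra ot => ou; case: (t) us => r /= us;
   apply/orP; right; apply/hasP; exists u.
Qed.
End Avoiding.

(** A pair in increasing order becomes a binary node, any other pair is reversed first; each of the
    two kinds injects into [M], hence the factor 2. The abstract weight covers both generating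
    functions and plain counting. *)
Lemma pair_le (P Q M : seq cotree) (w : cotree -> R) : uniq P -> uniq Q ->
  (forall t, 0 <= w t) -> (forall a b, w (Node [:: a; b]) = w a * w b) ->
  (forall a b, a \in P -> b \in Q -> cotree_le a b -> Node [:: a; b] \in M) ->
  (forall a b, a \in P -> b \in Q -> cotree_le b a -> Node [:: b; a] \in M) ->
  (\sum_(t <- P) w t) * (\sum_(t <- Q) w t) <= 2 * \sum_(t <- M) w t.
Proof.
move=> uP uQ w0 wN M1 M2; pose PQ := [seq (a, b) | a <- P, b <- Q].
have -> : (\sum_(t <- P) w t) * (\sum_(t <- Q) w t)
   = \sum_(u <- PQ) w u.1 * w u.2.
  rewrite big_allpairs big_distrl /=; apply: eq_bigr => a _; by rewrite big_distrr.
have uPQ : uniq PQ by apply: allpairs_uniq => // -[? ?] [].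
have PQP u : u \in PQ -> u.1 \in P /\ u.2 \in Q.
  by case/allpairsP=> -[a b] /= [aP bQ ->].
rewrite (bigID (fun u => cotree_le u.1 u.2)) /= mulrDl mul1r -!(big_filter PQ).
apply: lerD.
  rewrite (eq_bigr (fun u => w (Node [:: u.1; u.2]))); last by move=> u _; rewrite wN.
  rewrite -(big_map (fun u => Node [:: u.1; u.2]) predT w).
  apply: ler_sum_subset => //.
    by rewrite map_inj_uniq ?filter_uniq // => -[a b] [c d] /= [-> ->].
  by move=> _ /mapP[u + ->]; rewrite mem_filter => /andP[le /PQP[uP' uQ']]; exact: M1.
rewrite (eq_bigr (fun u => w (Node [:: u.2; u.1]))); last by move=> u _; rewrite wN mulrC.
rewrite -(big_map (fun u => Node [:: u.2; u.1]) predT w).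
apply: ler_sum_subset => //.
  by rewrite map_inj_uniq ?filter_uniq // => -[a b] [c d] /= [-> ->].
move=> _ /mapP[u + ->]; rewrite mem_filter => /andP[le /PQP[uP' uQ']]; apply: M2 => //.
by have := cotree_le_total u.1 u.2; rewrite (negbTE le).
Qed.

Lemma canonical_pair a b : canonical a -> canonical b -> cotree_le a b ->
  canonical (Node [:: a; b]).
Proof. by move=> ca cb ab; apply/canonicalP; split=> //=; rewrite ?ca ?cb ?ab. Qed.

Lemma gf_sqr_le N x : 0 <= x -> gf (trees N) x ^+ 2 <= 2 * gf (trees (N + N)) x.
Proof.
move=> x0; rewrite expr2; apply: pair_le; rewrite ?uniq_trees //.
- by move=> t; exact: exprn_ge0.
- by move=> a b /=; rewrite addn0 exprD.
- move=> a b; rewrite !mem_trees => /andP[ca la] /andP[cb lb] ab.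
  by rewrite canonical_pair //= addn0 leq_add.
- move=> a b; rewrite !mem_trees => /andP[ca la] /andP[cb lb] ab.
  by rewrite canonical_pair //= addn0 leq_add.
Qed.

Definition level n := [seq t <- trees n | leaves t == n].

Lemma mem_level n t : (t \in level n) = canonical t && (leaves t == n).
Proof.
by rewrite mem_filter mem_trees andbCA; case: eqP => [->|]; rewrite ?leqnn ?andbF.
Qed.

Lemma size_level_mul m n : (size (level m) * size (level n) <= 2 * size (level (m + n)))%N.
Proof.
have sz L : (size L)%:R = \sum_(t <- L) (1 : R).
  by rewrite big_const_seq count_predT iter_addr_0.
rewrite -(ler_nat R) !natrM !sz; apply: pair_le; rewrite ?filter_uniq ?uniq_trees //.
- by move=> a b; rewrite mulr1.
- move=> a b; rewrite !mem_level => /andP[ca /eqP la] /andP[cb /eqP lb] ab.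
  by rewrite canonical_pair //= addn0 la lb.
- move=> a b; rewrite !mem_level => /andP[ca /eqP la] /andP[cb /eqP lb] ab.
  by rewrite canonical_pair //= addn0 la lb addnC.
Qed.
End Sums.

(** * Generating functions near the radius of convergence *)

From Stdlib Require Rtrigo_def Rpower Exp_prop.
From mathcomp Require Import Rstruct classical_sets reals.

(** * Elementary real inequalities *)

Section RealEstimates.
Variable R : realType.
Local Open Scope ring_scope.
Implicit Types x y r d : R.

Lemma bernoulli d n : 0 <= d -> d <= 1 -> 1 - n%:R * d <= (1 - d) ^+ n.
Proof.
move=> d0 d1; elim: n => [|n IH]; first by rewrite expr0; lra.
rewrite exprS; apply: le_trans (ler_wpM2l _ IH); last by lra.
have : 0 <= n%:R * d * d by rewrite !mulr_ge0.
rewrite -natr1; lra.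
Qed.

Lemma bernoulliD d n : 0 <= d -> 1 + n%:R * d <= (1 + d) ^+ n.
Proof.
move=> d0; elim: n => [|n IH]; first by rewrite expr0; lra.
rewrite exprS; apply: le_trans (ler_wpM2l _ IH); last by lra.
have : 0 <= n%:R * d * d by rewrite !mulr_ge0.
rewrite -natr1; lra.
Qed.

Lemma exists_expr_lt r d : 0 <= r -> r < 1 -> 0 < d -> exists J, r ^+ J < d.
Proof.
move=> r0 r1 d0; have [->|rN0] := eqVneq r 0; first by exists 1%N; rewrite expr1.
have rgt0 : 0 < r by rewrite lt_neqAle eq_sym rN0.
pose h := r^-1 - 1; have h0 : 0 < h by rewrite subr_gt0 invf_gt1.
have dh : 0 < (d * h)^-1 by rewrite invr_gt0 mulr_gt0.
exists (Num.bound (d * h)^-1).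
set J := Num.bound _; have JP : (d * h)^-1 < J%:R by apply: archi_boundP; exact: ltW.
have B := bernoulliD J (ltW h0).
have rE : 1 + h = r^-1 by rewrite /h; ring.
rewrite rE exprVn in B.
have rJ : 0 < r ^+ J by rewrite exprn_gt0.
rewrite -(ltr_pM2r (x := (r ^+ J)^-1)) ?invr_gt0 // divff ?gt_eqF //.
apply: lt_le_trans (ler_wpM2l (ltW d0) B).
have : d * h * (d * h)^-1 < d * h * J%:R by rewrite ltr_pM2l // mulr_gt0.
rewrite divff ?gt_eqF ?mulr_gt0 //; nra.
Qed.

(** Stands in for passages to the limit in sums and products. *)
Lemma le_of_mul1B (P K : R) : (forall d, 0 < d -> d < 1 -> P * (1 - d) <= K) -> P <= K.
Proof.
move=> H; have [//|KP] := leP P K; have [P0|P0] := leP P 0.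
  have := H (1/2) ltac:(lra) ltac:(lra); have := H (1/4) ltac:(lra) ltac:(lra); nra.
pose d := Num.min (1 / 2) ((P - K) / (2 * P)).
have e0 : 0 < (P - K) / (2 * P) by rewrite divr_gt0 //; lra.
have d0 : 0 < d by rewrite lt_min e0; lra.
have d1 : d <= 1 / 2 by rewrite ge_min lexx.
have d2 : d <= (P - K) / (2 * P) by rewrite ge_min lexx orbT.
have : P * d <= (P - K) / 2.
  apply: le_trans (ler_wpM2l (ltW P0) d2) _.
  rewrite le_eqVlt; apply/orP; left; apply/eqP; field; lra.
have := H d d0 ltac:(lra); lra.
Qed.

Lemma mulrn_expr_le (q : R) k : 0 <= q -> q < 1 -> k%:R * q ^+ k * (1 - q) <= 1.
Proof.
(* The stronger bound, which says [k * q ^ k <= 1 + q + ... + q ^ (k - 1)], is the one that passes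
   through the induction. *)
move=> q0 q1; suff : k%:R * q ^+ k * (1 - q) <= 1 - q ^+ k.
  have : 0 <= q ^+ k by rewrite exprn_ge0.
  lra.
elim: k => [|k IH]; first by rewrite expr0; lra.
have qk : 0 <= q ^+ k by rewrite exprn_ge0.
have qk1 : q ^+ k <= 1 by rewrite exprn_ile1 // ltW.
have := ler_wpM2l q0 IH; rewrite exprS -natr1.
have : 0 <= (1 - q) * (1 - q * q ^+ k) by rewrite mulr_ge0 //; nra.
nra.
Qed.

Lemma expr_sub_le x y k : 0 <= x -> x <= y -> y ^+ k - x ^+ k <= (y - x) * (k%:R * y ^+ k.-1).
Proof.
move=> x0 xy; rewrite subrXX ler_wpM2l ?subr_ge0 //.
have -> : k%:R * y ^+ k.-1 = \sum_(i < k) y ^+ k.-1.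
  by rewrite sumr_const card_ord mulr_natl.
apply: ler_sum => i _.
have -> : y ^+ k.-1 = y ^+ (k.-1 - i) * y ^+ i.
  by rewrite -exprD; congr (_ ^+ _); have := ltn_ord i; lia.
rewrite ler_wpM2l ?exprn_ge0 //; first exact: le_trans xy.
by apply: lerXn2r; rewrite ?nnegrE //; exact: le_trans xy.
Qed.

Lemma geom_ratio_le J x y : 0 <= x -> x <= y -> y < 1 ->
  \sum_(j < J) y ^+ j <= (1 - x) / (1 - y) * \sum_(j < J) x ^+ j.
Proof.
move=> x0 xy y1; rewrite mulrAC ler_pdivlMr ?subr_gt0 //.
have geo (z : R) : (\sum_(j < J) z ^+ j) * (1 - z) = 1 - z ^+ J.
  by rewrite mulrC -[1 - z]opprB mulNr -subrX1 opprB.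
rewrite geo [(1 - x) * _]mulrC geo.
have : x ^+ J <= y ^+ J by apply: lerXn2r; rewrite ?nnegrE //; exact: le_trans xy.
lra.
Qed.

End RealEstimates.

Lemma trees_subset M N : (M <= N)%N -> {subset trees M <= trees N}.
Proof. by move=> MN t; rewrite !mem_trees => /andP[-> /leq_trans->]. Qed.

(** * The radius of convergence and the growth of the number of cotrees *)

Section Growth.
Variable R : realType.
Local Open Scope ring_scope.
Implicit Types (x y r d : R) (L : seq cotree).

Lemma gf_ge0 L x : 0 <= x -> 0 <= gf L x.
Proof. by move=> x0; apply: sumr_ge0 => t _; exact: exprn_ge0. Qed.

Lemma gf_le L x y : 0 <= x -> x <= y -> gf L x <= gf L y.
Proof.
move=> x0 xy; apply: ler_sum => t _; apply: lerXn2r; rewrite ?nnegrE //.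
exact: le_trans xy.
Qed.

Lemma gf_subset L L' x : 0 <= x -> uniq L -> {subset L <= L'} -> gf L x <= gf L' x.
Proof. by move=> x0 uL sub; apply: ler_sum_subset => // t; exact: exprn_ge0. Qed.

Lemma gf_trees_le M N x : 0 <= x -> (M <= N)%N -> gf (trees M) x <= gf (trees N) x.
Proof. by move=> x0 MN; apply: gf_subset (trees_subset MN); rewrite ?uniq_trees. Qed.

(* A canonical cotree other than [leaf] is [Node [:: a; b]] or
   [Node (a :: children t)] for smaller canonical cotrees [a], [b], [t]. *)
Lemma gf_trees_rec N x : 0 <= x ->
  gf (trees N.+1) x <= x + 2 * gf (trees N) x ^+ 2.
Proof.
move=> x0; pose T := trees N; pose T' := rem leaf T.
pose S := leaf :: [seq Node [:: a; b] | a <- T, b <- T] ++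
                  [seq Node (a :: children t) | a <- T, t <- T'].
have H : gf (trees N.+1) x <= gf S x.
  apply: gf_subset; rewrite ?uniq_trees // => -[s]; rewrite mem_trees => /andP[+ lN].
  case/canonicalP; case: s lN => [|a [|b s]] lN // _ cs ss.
  have aT : a \in T.
    rewrite mem_trees (allP cs) ?mem_head //= -ltnS; apply: leq_trans lN.
    by rewrite weight_leaves //; apply: leaves_lt_weight; rewrite ?mem_head.
  rewrite /S inE mem_cat; apply/orP; right; apply/orP; case: s lN cs ss => [|c s] lN cs ss.
    left; apply/allpairsP; exists (a, b); split=> //=.
    rewrite mem_trees (allP cs) ?inE ?eqxx ?orbT //= -ltnS; apply: leq_trans lN.
    by rewrite weight_leaves //; apply: leaves_lt_weight; rewrite ?inE ?eqxx ?orbT.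
  right; apply/allpairsP; exists (a, Node [:: b, c & s]); split=> //=.
  rewrite mem_rem_leaf ?uniq_trees // mem_trees; apply/and3P; split; first exact/eqP.
    apply/canonicalP; split=> //; first by case/andP: cs.
    by case/andP: ss.
  move: lN; rewrite !weight_leaves // -[weight _]/(leaves a + weight [:: b, c & s])%N => lN.
  by rewrite -ltnS; apply: leq_trans lN; rewrite -[X in (X < _)%N]add0n ltn_add2r leaves_gt0.
apply: le_trans H _; rewrite /gf big_cons big_cat /= expr1 lerD2l !big_allpairs_dep mulrDl mul1r.
apply: lerD; rewrite expr2 big_distrl /=.
  apply: ler_sum => a _; rewrite big_distrr /=; apply: ler_sum => b _.
  by rewrite addn0 exprD.
apply: ler_sum => a _.
have -> : \sum_(t <- T') x ^+ (leaves a + sumn (map leaves (children t)))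
    = x ^+ leaves a * gf T' x.
  rewrite /gf big_distrr; apply: eq_big_seq => t; rewrite mem_rem_leaf ?uniq_trees // mem_trees.
  case/and3P=> tl ct _; rewrite exprD; congr (_ * x ^+ _).
  exact: weight_children (canonical_gt1 ct tl).
rewrite ler_wpM2l ?exprn_ge0 // gf_subset ?rem_uniq ?uniq_trees //.
by move=> t /mem_rem.
Qed.

(* The bound 2 is not restrictive: any larger bound gives the same set by
   [gf_bounded_le2]. *)
Definition admissible : set R := [set x | 0 <= x /\ forall N, gf (trees N) x <= 2].

(** Suppose a value [u > 2] occurs, and let [S] be the supremum of the values. Since [gf_sqr_le]
    bounds every square by [2 * S], each value times [u] is at most [2 * S]; thus
    [S <= 2 * S / u < S]. *)
Lemma gf_bounded_le2 x M : 0 <= x -> (forall N, gf (trees N) x <= M) ->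
  forall N, gf (trees N) x <= 2.
Proof.
move=> x0 HM; set A := range (fun N => gf (trees N) x).
have supA : has_sup A by split; [exists (gf (trees 0) x); exists 0%N | exists M => _ [N _ <-]].
have leS N : gf (trees N) x <= sup A by apply: sup_upper_bound => //; exists N.
move=> N0; rewrite leNgt; apply/negP => gt2.
set u := gf (trees N0) x in gt2.
have S_le : sup A <= 2 * sup A / u.
  apply: ge_sup; first by case: supA.
  move=> _ [N _ <-]; rewrite ler_pdivlMr; last lra.
  have [NN0|NN0] := leqP N N0.
    have : gf (trees N) x <= u by exact: gf_trees_le.
    have := gf_sqr_le N0 x0; have := leS (N0 + N0)%N; have := gf_ge0 (trees N) x0.
    rewrite -/u expr2; nra.
  have : u <= gf (trees N) x by apply: gf_trees_le => //; exact: ltnW.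
  have := gf_sqr_le N x0; have := leS (N + N)%N; have := gf_ge0 (trees N) x0.
  rewrite expr2; nra.
move: S_le; rewrite ler_pdivlMr; last lra.
have := leS N0; rewrite -/u; nra.
Qed.

Lemma admissible_small : admissible (1 / 8).
Proof.
split; first by lra.
(* The map sending [g] to [1 / 8 + 2 * g ^ 2] preserves the interval [[0, 1 / 4]]. *)
suff H N : gf (trees N) (1 / 8 : R) <= 1 / 4 by move=> N; have := H N; lra.
elim: N => [|N IH]; first by rewrite /gf big_nil; lra.
have x0 : 0 <= 1 / 8 :> R by lra.
have := gf_trees_rec N x0; have := gf_ge0 (trees N) x0; rewrite expr2; nra.
Qed.

Definition radius : R := sup admissible.

Lemma has_sup_admissible : has_sup admissible.
Proof.
split; first by exists (1 / 8); exact: admissible_small.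
exists 2 => x [_ /(_ 1%N)]; apply: le_trans.
have -> : gf (trees 1) x = x; last by [].
by rewrite /gf big_seq1 expr1.
Qed.

Lemma radius_gt0 : 0 < radius.
Proof.
apply: (@lt_le_trans _ _ (1 / 8)); first by lra.
by apply: sup_upper_bound admissible_small; exact: has_sup_admissible.
Qed.

(** A truncation is a polynomial of degree at most [N] with nonnegative coefficients, so going from
    [radius] down to [radius * (1 - e)] loses at most a factor [1 - N * e], by Bernoulli's
    inequality. *)
Lemma gf_radius_le2 N : gf (trees N) radius <= 2.
Proof.
have r0 := radius_gt0; apply: le_of_mul1B => d d0 d1.
pose e := d / N.+1%:R.
have N0 : 0 < N.+1%:R :> R by rewrite ltr0n.
have e0 : 0 < e by rewrite divr_gt0.
have eN : N.+1%:R * e = d by rewrite /e mulrC divfK // gt_eqF.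
have e1 : e < 1.
  have : 1 <= N.+1%:R :> R by rewrite ler1n.
  nra.
have [x [x0 xA] lt] : exists2 x, admissible x & radius * (1 - e) < x.
  have [|x xA xr] := @sup_adherent _ admissible (radius * e) _ has_sup_admissible.
    by rewrite mulr_gt0.
  by exists x => //; move: xr; rewrite -/radius; lra.
apply: le_trans (xA N).
have re0 : 0 <= radius * (1 - e) by rewrite mulr_ge0; lra.
apply: le_trans (gf_le _ re0 (ltW lt)).
rewrite /gf mulr_suml [leLHS]big_seq [leRHS]big_seq; apply: ler_sum => t.
rewrite mem_trees => /andP[_ lN]; rewrite exprMn ler_wpM2l ?exprn_ge0 ?(ltW r0) //.
apply: le_trans (bernoulli (leaves t) (ltW e0) (ltW e1)).
by rewrite lerD2l lerN2 -eN ler_wpM2r ?ler_nat ?(ltW e0) // leqW.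
Qed.

Lemma gt_radius x : radius < x -> exists N, 2 < gf (trees N) x.
Proof.
move=> rx; apply/not_existsP => H; have : x <= radius; last by rewrite leNgt rx.
apply: sup_upper_bound; first exact: has_sup_admissible.
split; first exact: le_trans (ltW radius_gt0) (ltW rx).
by move=> N; rewrite leNgt; apply/negP; exact: H.
Qed.

Lemma gf_trees_succ N x :
  gf (trees N.+1) x = gf (trees N) x + (size (level N.+1))%:R * x ^+ N.+1.
Proof.
have pe : perm_eq (trees N.+1) (trees N ++ level N.+1).
  apply: uniq_perm; first exact: uniq_trees.
    rewrite cat_uniq uniq_trees filter_uniq ?uniq_trees // andbT.
    apply/hasPn => t; rewrite mem_level mem_trees => /andP[_ /eqP->].
    by rewrite ltnn andbF.
  move=> t; rewrite mem_cat mem_level !mem_trees -andb_orr (leq_eqVlt _ N.+1) ltnS.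
  by rewrite orbC.
rewrite /gf (perm_big _ pe) big_cat /=; congr (_ + _).
rewrite (eq_big_seq (fun=> x ^+ N.+1)); last by move=> t; rewrite mem_level => /andP[_ /eqP->].
by rewrite big_const_seq count_predT iter_addr_0 mulr_natl.
Qed.

Lemma canonical_nseq n : canonical (Node (nseq n.+2 leaf)).
Proof.
apply/canonicalP; split; [by [] | by apply/allP => t /nseqP[->] | ].
rewrite [nseq _ _]/= -[sorted _ _]/(path cotree_le leaf (nseq n.+1 leaf)).
by elim: n.+1.
Qed.

Lemma level_gt0 n : (0 < n)%N -> (0 < size (level n))%N.
Proof.
move=> n0; suff [t tn] : exists t, t \in level n by case: (level n) tn.
case: n n0 => [|[|n]] // _; first by exists leaf; rewrite mem_level.
exists (Node (nseq n.+2 leaf)); rewrite mem_level canonical_nseq weight_leaves //.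
by rewrite /weight map_nseq sumn_nseq [leaves leaf]/= mul1n eqxx.
Qed.

(** At a point that is at least 1 every level contributes at least 1, so three levels exceed the
    bound 2. *)
Lemma radius_lt1 : radius < 1.
Proof.
rewrite ltNge; apply/negP => r1.
have H N : N%:R <= gf (trees N) radius.
  elim: N => [|N IH]; first exact: gf_ge0 (ltW radius_gt0).
  by rewrite gf_trees_succ -natr1 lerD // mulr_ege1 ?exprn_ege1 // ler1n level_gt0.
by have := le_trans (H 3) (gf_radius_le2 3); rewrite ler_nat.
Qed.

(** The halved terms [v n] are supermultiplicative. If all were at most 1, the generating function
    would be bounded at some point between the radius and [x]; so [v m > 1] for some [m], and
    removing [m] repeatedly bounds [v n] below by the minimum over [0 < n <= m]. *)
Lemma level_lower_bound x : radius < x ->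
  exists2 c, 0 < c & forall n, (0 < n)%N -> c <= (size (level n))%:R * x ^+ n.
Proof.
move=> rx; have r0 := radius_gt0; have x0 : 0 < x by exact: lt_trans rx.
pose v n := (size (level n))%:R * x ^+ n / 2.
have v_gt0 n : (0 < n)%N -> 0 < v n.
  by move=> n0; rewrite divr_gt0 // mulr_gt0 ?exprn_gt0 // ltr0n level_gt0.
have v_mul m n : v m * v n <= v (m + n)%N.
  have := size_level_mul R m n; rewrite -(ler_nat R) !natrM => H.
  have : 0 <= x ^+ (m + n) by rewrite exprn_ge0 // ltW.
  rewrite /v exprD; move: H; set a := _%:R; set b := _%:R; set c := (size _)%:R; nra.
have [m m0 vm] : exists2 m, (0 < m)%N & 1 < v m.
  apply: contrapT => H.
  have vle n : (0 < n)%N -> (size (level n))%:R * x ^+ n <= 2.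
    move=> n0; have : v n <= 1 by rewrite leNgt; apply/negP => ?; apply: H; exists n.
    by rewrite /v; lra.
  pose y := (radius + x) / 2.
  have ry : radius < y by rewrite /y; lra.
  have yx : y < x by rewrite /y; lra.
  have y0 : 0 < y by lra.
  have q0 : 0 <= y / x by rewrite divr_ge0 // ltW.
  have q1 : y / x < 1 by rewrite ltr_pdivrMr // mul1r.
  have B N : gf (trees N) y <= 2 * \sum_(i < N.+1) (y / x) ^+ i.
    elim: N => [|N IH]; first by rewrite /gf big_nil mulr_ge0 ?sumr_ge0 // => i _; exact: exprn_ge0.
    rewrite gf_trees_succ big_ord_recr /= mulrDr lerD //.
    have := vle N.+1 isT; have -> : (y / x) ^+ N.+1 = y ^+ N.+1 / x ^+ N.+1.
      by rewrite expr_div_n.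
    move: (exprn_gt0 N.+1 x0) (exprn_gt0 N.+1 y0).
    move: (y ^+ _) (x ^+ _) => a c c0 a0 H1.
    by rewrite [leRHS]mulrA ler_pdivlMr // mulrAC ler_wpM2r // (ltW a0).
  have [N] := gt_radius ry; apply/negP; rewrite -leNgt.
  apply: (@gf_bounded_le2 _ (2 * (1 - y / x)^-1)); first exact: ltW.
  move=> M; apply: le_trans (B M) _; rewrite ler_wpM2l //.
  rewrite -[X in _ <= X]mul1r ler_pdivlMr ?subr_gt0 // mulrC -[1 - _]opprB mulNr -subrX1 opprB.
  have : 0 <= (y / x) ^+ M.+1 by rewrite exprn_ge0.
  lra.
have [c c0 cP] : exists2 c, 0 < c & forall n, (0 < n <= m)%N -> c <= v n.
  elim: (m) => [|k [c c0 cP]]; first by exists 1 => // -[].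
  exists (Num.min c (v k.+1)); first by rewrite lt_min c0 v_gt0.
  move=> n /andP[n0]; rewrite leq_eqVlt ltnS => /orP[/eqP->|nk].
    by rewrite ge_min lexx orbT.
  by rewrite ge_min cP ?n0.
exists c => // n n0; suff : c <= v n by have := v_gt0 n n0; rewrite /v; lra.
elim/ltn_ind: n n0 => n IH n0; have [nm|nm] := leqP n m; first by apply: cP; rewrite n0.
have nm0 : (0 < n - m)%N by rewrite subn_gt0.
have lt : (n - m < n)%N by rewrite ltn_subrL m0.
have cv := IH _ lt nm0.
have := v_mul m (n - m)%N; rewrite subnKC ?(ltnW nm) //; have := v_gt0 _ nm0; nra.
Qed.
End Growth.

(** * Euler products near the radius of convergence *)

Section Avoidance.
(** The exponential enters through its functional equation and the tangent bound at 0; positivity,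
    monotonicity and [expR x <= (1 - x)^-1] for [x < 1] follow. *)
Variables (R : realType) (expR : R -> R).
Local Open Scope ring_scope.
Hypothesis expRD : forall x y, expR (x + y) = expR x * expR y.
Hypothesis expR_ge1Dx : forall x, 1 + x <= expR x.
Implicit Types (x y r d : R) (L : seq cotree).

Lemma expR0 : expR 0 = 1.
Proof.
have e1 : 1 <= expR 0 by rewrite -{1}[1]addr0 expR_ge1Dx.
have : expR 0 * expR 0 = expR 0 * 1 by rewrite -expRD addr0 mulr1.
by apply: mulfI; rewrite gt_eqF //; lra.
Qed.

Lemma expRxMexpNx_1 x : expR x * expR (- x) = 1.
Proof. by rewrite -expRD subrr expR0. Qed.

Lemma expR_gt0 x : 0 < expR x.
Proof.
have -> : expR x = expR (x / 2) ^+ 2.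
  by rewrite expr2 -expRD; congr expR; field.
rewrite exprn_even_gt0 //=; apply: contra_eq_neq (expRxMexpNx_1 (x / 2)) => ->.
by rewrite mul0r eq_sym oner_neq0.
Qed.

Lemma expR_ge0 x : 0 <= expR x.
Proof. exact: ltW (expR_gt0 x). Qed.

Lemma expRN x : expR (- x) = (expR x)^-1.
Proof.
by apply: (mulfI (lt0r_neq0 (expR_gt0 x))); rewrite expRxMexpNx_1 divff ?gt_eqF ?expR_gt0.
Qed.

Lemma ler_expR : {mono expR : x y / x <= y}.
Proof.
apply: le_mono => x y xy; rewrite -[y](subrK x) expRD -[ltLHS]mul1r.
by rewrite ltr_pM2r ?expR_gt0 //; apply: lt_le_trans (expR_ge1Dx _); lra.
Qed.

Local Notation rho := (radius R).

Definition gf_at_radius : R := sup (range (fun N => gf (trees N) rho)).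
Local Notation T := gf_at_radius.

Let rho0 : 0 < rho := radius_gt0 R.
Let rho1 : rho < 1 := radius_lt1 R.

Lemma has_sup_gf_radius : has_sup (range (fun N => gf (trees N) rho)).
Proof.
split; first by exists (gf (trees 0) rho); exists 0%N.
by exists 2 => _ [N _ <-]; exact: gf_radius_le2.
Qed.

Lemma gf_le_at_radius N : gf (trees N) rho <= T.
Proof. by apply: sup_upper_bound; [exact: has_sup_gf_radius | exists N]. Qed.

Lemma at_radius_le2 : T <= 2.
Proof.
apply: ge_sup; first by case: has_sup_gf_radius.
by move=> _ [N _ <-]; exact: gf_radius_le2.
Qed.

Lemma gf_approx d : 0 < d -> exists N, T - d < gf (trees N) rho.
Proof.
by move=> d0; have [_ [N _ <-] H] := sup_adherent d0 has_sup_gf_radius; exists N.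
Qed.

Lemma expr_leaves01 x t : 0 <= x -> x < 1 -> 0 <= x ^+ leaves t < 1.
Proof. by move=> x0 x1; rewrite exprn_ge0 // exprn_ilt1 // -lt0n leaves_gt0. Qed.

(** The truncated geometric sums are [(1 - u ^ J.+1) / (1 - u)] with [u = rho ^ leaves t]. For large
    [J] the product of the numerators is at least [1 - d], so the bound [1 + T + (T - rho)] on the
    truncated products passes to the limit. *)
Lemma prod_inv_trees_le N :
  \prod_(t <- trees N) (1 - rho ^+ leaves t)^-1 <= 1 + 2 * T - rho.
Proof.
set K := 1 + 2 * T - rho.
have u01 t := @expr_leaves01 rho t (ltW rho0) rho1.
have HJ J : \prod_(t <- trees N) \sum_(j < J.+1) (rho ^+ leaves t) ^+ j <= K.
  have [M H] := prod_trees_le J N (ltW rho0); apply: le_trans H _.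
  by have := gf_le_at_radius N; have := gf_le_at_radius M; rewrite /K; lra.
apply: le_of_mul1B => d d0 d1.
(* Bernoulli's inequality for [n] factors [1 - e] loses [n * e <= d]. *)
pose n := size (trees N); pose e := d / n.+1%:R.
have n0 : 0 < n.+1%:R :> R by rewrite ltr0n.
have e0 : 0 < e by rewrite divr_gt0.
have e1 : e <= 1.
  rewrite ler_pdivrMr // mul1r; apply: le_trans (ltW d1) _; by rewrite ler1n.
have [J rJ] := exists_expr_lt (ltW rho0) rho1 e0.
apply: le_trans (HJ J).
have -> : \prod_(t <- trees N) \sum_(j < J.+1) (rho ^+ leaves t) ^+ j =
    \prod_(t <- trees N) (1 - rho ^+ leaves t)^-1 *
    \prod_(t <- trees N) (1 - (rho ^+ leaves t) ^+ J.+1).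
  rewrite -big_split; apply: eq_bigr => t _ /=; have /andP[_ u1] := u01 t.
  apply: (mulfI (x := 1 - rho ^+ leaves t)); first by rewrite subr_eq0 gt_eqF.
  rewrite mulrA divff ?mul1r ?subr_eq0 ?gt_eqF //.
  by rewrite -[1 - rho ^+ leaves t]opprB mulNr -subrX1 opprB.
apply: ler_wpM2l.
  by apply: prodr_ge0 => t _; rewrite invr_ge0 subr_ge0; case/andP: (u01 t) => _ /ltW.
have : 1 - n%:R * e <= \prod_(t <- trees N) (1 - (rho ^+ leaves t) ^+ J.+1).
  apply: le_trans (bernoulli n (ltW e0) e1) _.
  rewrite -[n](count_predT (trees N)) -(iter_mulr_1) -big_const_seq.
  apply: ler_prod => t _; rewrite subr_ge0 e1 /=; rewrite lerD2l lerN2.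
  apply: le_trans (ltW rJ); rewrite -exprM.
  apply: ler_wiXn2l; rewrite ?(ltW rho0) ?(ltW rho1) //.
  by apply: leq_trans (leqnSn J) _; rewrite leq_pmull ?leaves_gt0.
apply: le_trans; rewrite lerD2l lerN2.
have : n.+1%:R * e = d by rewrite /e mulrC divfK // gt_eqF.
by rewrite -natr1; lra.
Qed.

Lemma exp_le_inv x : x < 1 -> expR x <= (1 - x)^-1.
Proof.
by move=> x1; rewrite -[expR x]invrK -expRN lef_pV2 ?posrE ?expR_gt0 ?subr_gt0 //.
Qed.

Lemma expR_sum_seq (I : Type) (s : seq I) (F : I -> R) :
  expR (\sum_(i <- s) F i) = \prod_(i <- s) expR (F i).
Proof. by rewrite (big_morph expR expRD expR0). Qed.

(** A cotree outside [L] contributes a factor [(1 - u)^-1 >= expR u] with [u = rho ^ leaves t], and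
    finitely many of these exponents add up to nearly [T - gf L rho]. *)
Lemma prod_inv_sub_le L N : uniq L -> {subset L <= trees N} ->
  \prod_(t <- L) (1 - rho ^+ leaves t)^-1 * expR (T - gf L rho) <= 1 + 2 * T - rho.
Proof.
move=> uL LN; have u01 t := @expr_leaves01 rho t (ltW rho0) rho1.
set P := \prod_(t <- L) _.
have P0 : 0 <= P.
  by apply: prodr_ge0 => t _; rewrite invr_ge0 subr_ge0; case/andP: (u01 t) => _ /ltW.
apply: le_of_mul1B => d d0 d1; have [M0 TM0] := gf_approx d0.
pose M := maxn M0 N; have LM : {subset L <= trees M}.
  by move=> t /LN; apply: trees_subset; rewrite leq_maxr.
have TM : T - d < gf (trees M) rho.
  by apply: lt_le_trans TM0 _; apply: gf_trees_le (ltW rho0) _; rewrite leq_maxl.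
pose L' := [seq t <- trees M | t \notin L].
have pe : perm_eq (trees M) (L ++ L').
  apply: uniq_perm; rewrite ?uniq_trees //.
    rewrite cat_uniq uL filter_uniq ?uniq_trees // andbT /=.
    by apply/hasPn => t; rewrite mem_filter => /andP[].
  move=> t; rewrite mem_cat mem_filter; case tL: (t \in L) => //=; exact: LM.
apply: le_trans (prod_inv_trees_le M); rewrite (perm_big _ pe) big_cat /= -/P -mulrA.
apply: ler_wpM2l => //.
have E : gf L' rho = gf (trees M) rho - gf L rho.
  by rewrite /gf (perm_big _ pe) big_cat /= addrAC subrr add0r.
apply: (@le_trans _ _ (expR (gf L' rho))).
  have -> : gf L' rho = T - gf L rho + - (T - gf (trees M) rho) by rewrite E; lra.
  rewrite (expRD (T - gf L rho)); apply: ler_wpM2l; first exact: expR_ge0.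
  by apply: le_trans (expR_ge1Dx _); lra.
rewrite /gf expR_sum_seq; apply: ler_prod => t _; rewrite expR_ge0 /=.
by apply: exp_le_inv; case/andP: (u01 t).
Qed.

(** The case of an empty list. It is used in the form [1 <= K * expR (- T)] with
    [K = 1 + 2 * T - rho]. *)
Lemma expR_at_radius_le : expR T <= 1 + 2 * T - rho.
Proof.
have := @prod_inv_sub_le [::] 0%N isT (fun t => id).
by rewrite big_nil mul1r /gf big_nil subr0.
Qed.

(* Chosen such that [rho < rho' < 1] and [rho' ^ 2 = rho * theta] with [theta < 1]. *)
Definition rho' : R := 2 * rho / (1 + rho).
Definition theta : R := 4 * rho / (1 + rho) ^+ 2.
Definition slope : R := 2 / (rho * (1 - rho') * (1 - theta)).

Lemma rho'P : [/\ rho < rho', rho' < 1, 0 <= theta, theta < 1 & rho' ^+ 2 = rho * theta].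
Proof.
have h : 0 < 1 + rho by have := rho0; lra.
split.
- rewrite ltr_pdivlMr //; have := rho0; have := rho1; nra.
- rewrite ltr_pdivrMr //; have := rho1; lra.
- by rewrite divr_ge0 ?exprn_ge0 //; have := rho0; lra.
- rewrite ltr_pdivrMr ?exprn_gt0 //; have := rho1; rewrite expr2; nra.
- by rewrite /rho' /theta; field; rewrite gt_eqF.
Qed.

Lemma slope_gt0 : 0 < slope.
Proof.
have [r1 r2 t0 t1 _] := rho'P.
by rewrite divr_gt0 // !mulr_gt0 ?subr_gt0.
Qed.

(* With [u = rho ^ k] and [v = x ^ k], [(1 - u) / (1 - v)] is at most
   [exp ((v - u) / (1 - v))], and [(v - u) / (1 - v) = (v - u) + (v - u) v / (1 - v)];
   the sum of the second-order terms is Lipschitz at [rho]. *)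
Lemma second_order_le L N x : uniq L -> {subset L <= trees N} -> rho <= x -> x <= rho' ->
  \sum_(t <- L) ((x ^+ leaves t - rho ^+ leaves t) * x ^+ leaves t / (1 - x ^+ leaves t))
  <= (x - rho) * slope.
Proof.
move=> uL LN rx xr; have [r1 r2 t0 t1 rt] := rho'P; have r0 := rho0.
have x0 : 0 < x by exact: lt_le_trans rx.
have x1 : x < 1 by exact: le_lt_trans xr r2.
pose c := (rho * (1 - rho') * (1 - theta))^-1.
have c0 : 0 < c by rewrite invr_gt0 !mulr_gt0 ?subr_gt0.
(* With [k = leaves t], the difference of powers is at most [(x - rho) * k * x ^ k.-1], and [k * x ^
   k * x ^ k <= k * theta ^ k * rho ^ k <= rho ^ k / (1 - theta)] because [x ^ 2 <= rho' ^ 2]. *)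
have main t : (x ^+ leaves t - rho ^+ leaves t) * x ^+ leaves t / (1 - x ^+ leaves t)
    <= (x - rho) * c * rho ^+ leaves t.
  set k := leaves t; have k0 : (0 < k)%N := leaves_gt0 t.
  have xk0 : 0 <= x ^+ k by rewrite exprn_ge0 // ltW.
  have xkx : x ^+ k <= x by rewrite -[leRHS]expr1; apply: ler_wiXn2l => //; exact: ltW.
  have inv : (1 - x ^+ k)^-1 <= (1 - rho')^-1.
    by rewrite lef_pV2 ?posrE ?subr_gt0 //; lra.
  have s := expr_sub_le k (ltW r0) rx.
  have kxk : x * (k%:R * x ^+ k.-1 * x ^+ k) <= rho ^+ k * (1 - theta)^-1.
    have -> : x * (k%:R * x ^+ k.-1 * x ^+ k) = k%:R * x ^+ k * x ^+ k.
      by have -> : x ^+ k = x * x ^+ k.-1 by [rewrite -exprS prednK]; ring.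
    apply: (@le_trans _ _ (k%:R * theta ^+ k * rho ^+ k)).
      rewrite -!mulrA ler_wpM2l // -!exprMn [theta * rho]mulrC -rt.
      have xle := ltW x0; have rle := ltW (lt_trans r0 r1).
      apply: lerXn2r; rewrite ?nnegrE; [exact: mulr_ge0 | exact: exprn_ge0 | ].
      by rewrite expr2; apply: ler_pM.
    rewrite mulrC ler_wpM2l ?exprn_ge0 ?(ltW r0) //.
    rewrite -[leRHS]mul1r ler_pdivlMr ?subr_gt0 //; exact: mulrn_expr_le.
  have kx : k%:R * x ^+ k.-1 * x ^+ k <= rho^-1 * (rho ^+ k * (1 - theta)^-1).
    rewrite ler_pdivlMl //; apply: le_trans kxk; apply: ler_wpM2r => //.
    by rewrite !mulr_ge0 ?exprn_ge0 // ltW.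
  have xr0 : 0 <= x - rho by rewrite subr_ge0.
  apply: (@le_trans _ _ ((x - rho) * (k%:R * x ^+ k.-1) * x ^+ k * (1 - rho')^-1)).
    apply: ler_pM => //; [| by rewrite invr_ge0 subr_ge0; lra | by apply: ler_wpM2r].
    rewrite mulr_ge0 // subr_ge0; apply: lerXn2r; rewrite ?nnegrE ?(ltW r0) ?(ltW x0) //.
  have -> : (x - rho) * (k%:R * x ^+ k.-1) * x ^+ k * (1 - rho')^-1
    = (x - rho) * (1 - rho')^-1 * (k%:R * x ^+ k.-1 * x ^+ k) by ring.
  have -> : (x - rho) * c * rho ^+ k
    = (x - rho) * (1 - rho')^-1 * (rho^-1 * (rho ^+ k * (1 - theta)^-1)).
    by rewrite /c !invfM; ring.
  by apply: ler_wpM2l kx; rewrite mulr_ge0 // invr_ge0 subr_ge0 ltW.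
apply: (@le_trans _ _ (\sum_(t <- L) (x - rho) * c * rho ^+ leaves t)).
  by apply: ler_sum => t _; exact: main.
rewrite -mulr_sumr -/(gf L rho) /slope -/c -mulrA ler_wpM2l ?subr_ge0 // mulrC.
rewrite ler_wpM2r ?(ltW c0) //.
exact: le_trans (gf_subset (ltW r0) uL LN) (gf_radius_le2 R N).
Qed.

(** Each geometric sum at [x] exceeds the one at [rho] by a factor of at most
    [1 + F t <= expR (F t)]. The exponents add up to [gf L x - gf L rho] and a second-order part,
    and [prod_inv_sub_le] bounds the product at [rho]. *)
Lemma prod_geom_le L N J x : uniq L -> {subset L <= trees N} -> rho <= x -> x <= rho' ->
  \prod_(t <- L) \sum_(j < J) (x ^+ leaves t) ^+ j
  <= (1 + 2 * T - rho) * expR (gf L x - T + (x - rho) * slope).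
Proof.
move=> uL LN rx xr; have [_ r2 _ _ _] := rho'P.
have x0 : 0 < x by exact: lt_le_trans rx.
have x1 : x < 1 by exact: le_lt_trans xr r2.
have u01 t := @expr_leaves01 rho t (ltW rho0) rho1.
have v01 t := @expr_leaves01 x t (ltW x0) x1.
pose F t := (x ^+ leaves t - rho ^+ leaves t) / (1 - x ^+ leaves t).
have step t : \sum_(j < J) (x ^+ leaves t) ^+ j <= (1 - rho ^+ leaves t)^-1 * expR (F t).
  have /andP[u0 u1] := u01 t; have /andP[v0 v1] := v01 t.
  have uv : rho ^+ leaves t <= x ^+ leaves t.
    by apply: lerXn2r; rewrite ?nnegrE ?(ltW rho0) ?(ltW x0).
  apply: le_trans (geom_ratio_le J u0 uv v1) _.
  have -> : (1 - rho ^+ leaves t) / (1 - x ^+ leaves t) = 1 + F t.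
    by rewrite /F; field; rewrite gt_eqF // subr_gt0.
  rewrite mulrC; apply: ler_pM;
    [by apply: sumr_ge0 => j _; rewrite exprn_ge0 | | | exact: expR_ge1Dx].
    by rewrite addr_ge0 // divr_ge0 // subr_ge0 // ltW.
  rewrite -[leRHS]mul1r ler_pdivlMr ?subr_gt0 // mulrC -[1 - _]opprB mulNr -subrX1 opprB.
  by have : 0 <= (rho ^+ leaves t) ^+ J; [rewrite exprn_ge0 | lra].
apply: (@le_trans _ _ (\prod_(t <- L) ((1 - rho ^+ leaves t)^-1 * expR (F t)))).
  apply: ler_prod => t _; rewrite step andbT.
  by apply: sumr_ge0 => j _; rewrite exprn_ge0 //; case/andP: (v01 t).
rewrite big_split /= -expR_sum_seq.
have FE : \sum_(t <- L) F t = gf L x - gf L rho +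
   \sum_(t <- L) ((x ^+ leaves t - rho ^+ leaves t) * x ^+ leaves t / (1 - x ^+ leaves t)).
  rewrite /gf -sumrB -big_split /=; apply: eq_bigr => t _; rewrite /F; field.
  by rewrite gt_eqF // subr_gt0; case/andP: (v01 t).
have := second_order_le uL LN rx xr; set S := \sum_(t <- L) _ in FE * => SC.
apply: (@le_trans _ _ (\prod_(t <- L) (1 - rho ^+ leaves t)^-1 *
    expR (gf L x - gf L rho + (x - rho) * slope))).
  apply: ler_wpM2l; last by rewrite ler_expR FE lerD2l.
  by apply: prodr_ge0 => t _; rewrite invr_ge0 subr_ge0; case/andP: (u01 t) => _ /ltW.
have -> : gf L x - gf L rho + (x - rho) * slope
  = (T - gf L rho) + (gf L x - T + (x - rho) * slope) by lra.
rewrite expRD mulrA; apply: ler_wpM2r; first exact: expR_ge0.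
exact: prod_inv_sub_le uL LN.
Qed.

(** * Cotrees avoiding a pattern are rare *)

Section Pattern.
Variable p : cotree.
Hypotheses (cp : canonical p) (p_gt1 : (1 < leaves p)%N).

(** Starts the induction of [avoiding_bounded]: [p] itself is missing among the avoiding cotrees. *)
Lemma gf_avoiding_radius_le : gf (avoiding p (leaves p)) rho + rho ^+ leaves p <= T.
Proof.
have r0 := radius_gt0 R; apply: le_trans (gf_le_at_radius (leaves p)).
have -> : gf (avoiding p (leaves p)) rho + rho ^+ leaves p
    = gf (p :: avoiding p (leaves p)) rho by rewrite /gf big_cons addrC.
apply: gf_subset; first exact: ltW.
  rewrite /= filter_uniq ?uniq_trees // andbT mem_filter negb_and negbK.
  by case: (p) => s /=; rewrite eqxx.
move=> t; rewrite inE => /orP[/eqP->|]; last by rewrite mem_filter => /andP[].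
by rewrite mem_trees cp leqnn.
Qed.

Lemma gf_sub_le N L (x : R) : {subset L <= trees N} -> rho <= x -> x <= 1 ->
  gf L x <= gf L rho + (x - rho) * (N%:R * (size L)%:R).
Proof.
move=> LN rx x1; have r0 := radius_gt0 R; have x0 := le_trans (ltW r0) rx.
rewrite -lerBlDl /gf -sumrB.
apply: (@le_trans _ _ (\sum_(t <- L) (x - rho) * N%:R)).
  rewrite [leLHS]big_seq [leRHS]big_seq; apply: ler_sum => t /LN; rewrite mem_trees => /andP[_ lN].
  apply: le_trans (expr_sub_le _ (ltW r0) rx) _; rewrite ler_wpM2l ?subr_ge0 //.
  apply: le_trans (_ : (leaves t)%:R * 1 <= _); last by rewrite mulr1 ler_nat.
  by rewrite ler_wpM2l // exprn_ile1.
by rewrite big_const_seq count_predT iter_addr_0 [leRHS]mulrA [leRHS]mulr_natr.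
Qed.

Lemma exists_step (a b c d : R) : 0 < a -> 0 < b -> 0 < c -> 0 < d ->
  exists2 h, 0 < h & [/\ h <= a, h <= b, h <= c & h <= d].
Proof.
move=> a0 b0 c0 d0; exists (Num.min (Num.min a b) (Num.min c d)).
  by rewrite !lt_min a0 b0 c0 d0.
by split; rewrite !ge_min lexx ?orbT.
Qed.

(** Induction on [N] for the invariant [gf (avoiding p N) x <= T] at a point [x = rho + h]. The cost
    of moving from [rho] to [x] is linear in [h], whereas the slack [A] is fixed, so a small [h]
    works. *)
Lemma avoiding_bounded : exists2 x : R, rho < x & forall N, gf (avoiding p N) x <= 2.
Proof.
have r0 := radius_gt0 R; have r1 := radius_lt1 R.
have [r'1 r'2 _ _ _] := rho'P; have C0 := slope_gt0; set C := slope in C0.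
have T2 := at_radius_le2; have eT := expR_at_radius_le.
set K := 1 + 2 * T - rho in eT; set b := leaves p.
pose A := rho ^+ b; have A0 : 0 < A by rewrite exprn_gt0.
pose D : R := b%:R * (size (avoiding p b))%:R; have D0 : 0 <= D by rewrite mulr_ge0.
(* The four bounds on [h] keep [x <= rho'], give [E <= 1 / 2], absorb [K * expR E - K] and [h] into
   [A] using [K <= 5], and absorb the growth [h * D] in the base case. *)
have q1 : 0 < rho' - rho by rewrite subr_gt0.
have C2 : 0 < 2 * C by lra.
have q2 : 0 < 1 / (2 * C) by exact: divr_gt0.
have q3 : 0 < A / (10 * C + 1) by rewrite divr_gt0 //; lra.
have q4 : 0 < A / (D + 1) by rewrite divr_gt0 //; lra.
have [h h0 [h1 h2 h3 h4]] := exists_step q1 q2 q3 q4.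
rewrite (ler_pdivlMr _ _ C2) in h2.
rewrite ler_pdivlMr in h3; last lra.
rewrite ler_pdivlMr in h4; last lra.
pose x := rho + h; have rx : rho < x by rewrite /x; lra.
have xr' : x <= rho' by rewrite /x; lra.
have x0 : 0 < x by exact: lt_trans rx.
have xh : x - rho = h by rewrite /x; ring.
exists x => //.
have sub N : {subset avoiding p N <= trees N} by move=> t; rewrite mem_filter => /andP[].
have uA N : uniq (avoiding p N) by rewrite filter_uniq ?uniq_trees.
have mono M N : (M <= N)%N -> gf (avoiding p M) x <= gf (avoiding p N) x.
  move=> MN; apply: gf_subset; rewrite ?(ltW x0) // => t; rewrite !mem_filter => /andP[-> tM].
  exact: trees_subset tM.
suff H N : (b <= N)%N -> gf (avoiding p N) x <= T.
  move=> N; apply: le_trans (mono N (maxn b N) (leq_maxr _ _)) _.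
  exact: le_trans (H _ (leq_maxl _ _)) T2.
pose E := h * C; have E0 : 0 <= E by rewrite mulr_ge0 // ltW.
have E2 : E <= 1 / 2 by rewrite /E; lra.
have expE : expR E <= 1 + 2 * E.
  apply: le_trans (exp_le_inv _) _; first lra.
  rewrite -[leLHS]mul1r ler_pdivrMr; last lra.
  nra.
have T0 : 0 <= T by apply: le_trans (gf_ge0 (trees 0) (ltW r0)) (gf_le_at_radius 0).
have K0 : 0 < K by apply: lt_le_trans eT; exact: expR_gt0.
have KE : K * expR E <= K + A - h.
  have : K * expR E <= K * (1 + 2 * E) by rewrite ler_wpM2l // ltW.
  have : K * E <= 5 * E by rewrite ler_wpM2r // /K; lra.
  rewrite /E; lra.
elim: N => [|N IH]; first by rewrite leqNgt leaves_gt0.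
rewrite leq_eqVlt => /orP[/eqP bN|].
  rewrite -bN; apply: le_trans (gf_sub_le (sub b) (ltW rx) _) _.
    exact: le_trans xr' (ltW r'2).
  have := gf_avoiding_radius_le; rewrite -/b -/A xh -/D; lra.
rewrite ltnS => bN; have zT := IH bN.
set z := gf (avoiding p N) x in zT; have z0 : 0 <= z by exact: gf_ge0 (ltW x0).
have G := prod_geom_le N.+2 (uA N) (sub N) (ltW rx) xr'.
have F := avoiding_le cp p_gt1 (ltW x0) (leqW bN).
have {}F := le_trans F (lerD (lexx x) G); rewrite -/z -/K xh -/C -/E in F.
have Ax : A <= x ^+ leaves p by apply: lerXn2r; rewrite ?nnegrE ?(ltW x0) ?(ltW r0) ?(ltW rx).
(* For [f = K * expR E * expR (z - T)] the claim reads [T - z <= f * (expR (T - z) - 1)], and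
   [f >= 1] by [expR_at_radius_le]. *)
have key : K * expR (z - T + E) + (T - z) <= K * expR E.
  have -> : expR (z - T + E) = expR E * expR (z - T) by rewrite -expRD addrC.
  have e1 : 1 <= expR E by apply: le_trans (expR_ge1Dx _); lra.
  have e2 : expR (T - z) * expR (z - T) = 1 by rewrite -expRD -[in RHS]expR0; congr expR; ring.
  have e3 : T - z <= expR (T - z) - 1 by have := expR_ge1Dx (T - z); lra.
  have e4 : expR (- T) <= expR (z - T) by rewrite ler_expR; lra.
  have e5 : 1 <= K * expR (- T).
    by rewrite expRN -(ler_pM2r (expR_gt0 T)) mul1r divfK ?gt_eqF ?expR_gt0.
  have e6 : 1 <= K * expR (z - T) by apply: le_trans e5 _; rewrite ler_wpM2l // ltW.
  have e7 : 1 <= K * expR E * expR (z - T).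
    rewrite mulrAC; apply: le_trans e6 _; rewrite -[leLHS]mulr1.
    by rewrite ler_wpM2l // mulr_ge0 ?expR_ge0 // ltW.
  have e8 : T - z <= K * expR E * expR (z - T) * (expR (T - z) - 1).
    apply: le_trans e3 _; rewrite -[leLHS]mul1r ler_wpM2r //.
    by have := expR_ge1Dx (T - z); lra.
  have e9 : K * expR E * expR (z - T) * expR (T - z) = K * expR E.
    by rewrite -mulrA [expR (z - T) * _]mulrC e2 mulr1.
  move: e8 e9; move: (expR _) (expR _) (expR _) => e f g; lra.
(* In the sum of [F], [key] and [KE] the terms in [z], [A] and [h] cancel or have the right sign,
   and [K - 1 + rho - T = T]. *)
rewrite -/b in Ax; rewrite /K in KE key F; rewrite /x in F Ax *; lra.
Qed.

Definition avoiding_level n := [seq t <- level n | ~~ occurs p t].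

(** Avoiding cotrees number at most [2 * x ^ -n], all cotrees at least [c * y ^ -n] for some [y]
    between [rho] and [x]; the quotient decays like [(y / x) ^ n]. *)
Lemma avoiding_level_rare (m : nat) : exists N, forall n, (N <= n)%N ->
  (m * size (avoiding_level n) <= size (level n))%N.
Proof.
have [x rx xP] := avoiding_bounded; have r0 := radius_gt0 R.
pose y := (rho + x) / 2; have ry : rho < y by rewrite /y; lra.
have yx : y < x by rewrite /y; lra.
have y0 : 0 < y by lra. have x0 : 0 < x by lra.
have [c c0 cP] := level_lower_bound ry.
have q0 : 0 <= y / x by rewrite divr_ge0 // ltW.
have q1 : y / x < 1 by rewrite ltr_pdivrMr // mul1r.
have d0 : 0 < c / (2 * m%:R + 1) by rewrite divr_gt0 // ltr_wpDl // mulr_ge0.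
have [J HJ] := exists_expr_lt q0 q1 d0.
exists J.+1 => n Jn; rewrite -(ler_nat R) natrM.
have fn : (size (avoiding_level n))%:R * x ^+ n <= 2.
  apply: le_trans (xP n).
  have -> : (size (avoiding_level n))%:R * x ^+ n = gf (avoiding_level n) x.
    rewrite /gf (eq_big_seq (fun=> x ^+ n)).
      by rewrite big_const_seq count_predT iter_addr_0 mulr_natl.
    by move=> t; rewrite mem_filter mem_level => /andP[_ /andP[_ /eqP->]].
  apply: gf_subset; rewrite ?(ltW x0) ?filter_uniq ?uniq_trees //.
  move=> t; rewrite !mem_filter mem_trees => /andP[-> /andP[/eqP<- /andP[-> _]]].
  by rewrite leqnn.
have an := cP n (leq_trans (ltn0Sn J) Jn).
have qn : (y / x) ^+ n < c / (2 * m%:R + 1).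
  apply: le_lt_trans HJ; apply: ler_wiXn2l => //; [exact: ltW | exact: ltnW].
rewrite expr_div_n ltr_pdivlMr in qn; last by rewrite ltr_wpDl // mulr_ge0.
have yn := exprn_gt0 n y0; have xn := exprn_gt0 n x0.
rewrite -(ler_pM2r yn); apply: le_trans an.
rewrite mulrAC ltr_pdivrMr // in qn.
apply: le_trans (_ : m%:R * 2 / x ^+ n * y ^+ n <= _).
  by rewrite ler_wpM2r ?(ltW yn) // -mulrA ler_wpM2l // ler_pdivlMr.
rewrite mulrAC ler_pdivrMr //; apply: le_trans (ltW qn).
by move: yn; move: (y ^+ n) => z z0; lra.
Qed.
End Pattern.
End Avoidance.

(** * The limit *)

Local Open Scope ring_scope.

Lemma stdlib_expD (x y : Rdefinitions.R) :
  Rtrigo_def.exp (x + y) = Rtrigo_def.exp x * Rtrigo_def.exp y.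
Proof. exact: Exp_prop.exp_plus. Qed.

Lemma stdlib_exp_ge1Dx (x : Rdefinitions.R) : 1 + x <= Rtrigo_def.exp x.
Proof. by apply/RleP; exact: Rpower.exp_ineq1_le. Qed.

(* h_n / c_n --> 1 as n --> oo (epsilon-N definition of the limit, in rat). *)
Theorem theorem4p2 :
  forall eps : rat, 0 < eps ->
  exists N : nat, forall n : nat, (N <= n)%N ->
    `| (h_num n)%:R / (c_num n)%:R - 1 | < eps.
Proof.
move=> eps eps0.
have [p [q [cp p_gt1 wq cq pq]]] := exists_mates.
have [m mP] : exists m : nat, eps^-1 < m%:R.
  by exists (Num.bound eps^-1); apply: archi_boundP; rewrite invr_ge0 ltW.
have m0 : (0 < m)%N by rewrite -(ltr_nat rat); apply: lt_trans mP; rewrite invr_gt0.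
(* The 2 accounts for the two root types, and the successor makes [key] strict. *)
have [N NP] := avoiding_level_rare stdlib_expD stdlib_exp_ge1Dx cp p_gt1 (2 * m).+1.
(* The successor excludes [n = 0], since every cotree has a leaf. *)
exists N.+1 => n Nn; have n0 : (0 < n)%N by exact: leq_trans Nn.
have bad := card_mateless_le wq cq pq n0 (F := avoiding_level p n) _.
have {}bad : (c_num n - h_num n <= 2 * size (avoiding_level p n))%N.
  apply: bad => t ct lt ot; by rewrite mem_filter ot mem_level ct lt eqxx.
have cn : (size (level n) <= c_num n)%N.
  apply: card_classes_ge; first by rewrite filter_uniq ?uniq_trees.
  by move=> t; rewrite mem_level => /andP[ct /eqP].
have c0 : (0 < c_num n)%N by apply: leq_trans cn; exact: level_gt0.
have hc := h_num_le n.
have key : (m * (c_num n - h_num n) < c_num n)%N.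
  have := NP n (ltnW Nn); have := level_gt0 n0.
  move: (size (avoiding_level p n)) (size (level n)) bad cn => f a bad cn a0 H.
  have := leq_mul (leqnn m) bad; nia.
have cr : 0 < (c_num n)%:R :> rat by rewrite ltr0n.
have -> : (h_num n)%:R / (c_num n)%:R - 1 = - ((c_num n - h_num n)%:R / (c_num n)%:R) :> rat.
  by rewrite natrB // mulrBl divff ?gt_eqF // opprB.
rewrite normrN ger0_norm ?divr_ge0 // ltr_pdivrMr //.
have : (m * (c_num n - h_num n))%:R < (c_num n)%:R :> rat by rewrite ltr_nat.
rewrite natrM => H; rewrite -(ltr_pM2l (x := m%:R)) ?ltr0n //.
apply: lt_le_trans H _; rewrite mulrA -[leLHS]mul1r ler_wpM2r // ?(ltW cr) //.
by rewrite -(ler_pM2r (x := eps^-1)) ?invr_gt0 // mul1r mulfK ?gt_eqF // ltW.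
Qed.
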